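(* Let $\Omega\subset\mathbb{R}^n$ be a domain and let $R=\max_{x\in\overline{\Omega}}\operatorname{dist}(x,\Omega^c)$. Let $\lambda_{1,p}(\Omega)$ denote the principal eigenvalue $\lambda_1(\Omega)$ of $-L$ for the homogeneous $p$-laplacian $$Lu=\Delta_p^H u=\frac1p|\nabla u|^{2-p}\operatorname{div}\left(|\nabla u|^{p-2}\nabla u\right)=\frac{p-2}{p}\Delta_\infty^H u+\frac1p\Delta u,$$ and let $\lambda_{1,\infty}(\Omega)$ denote the principal eigenvalue $\lambda_1(\Omega)$ of $-L$ for the homogeneous infinity laplacian $$Lu=\Delta_\infty^H u=\left(\frac{\nabla u}{|\nabla u|}\right)^t D^2u\,\frac{\nabla u}{|\nabla u|}.$$ Then $$\lim_{p\to\infty}\lambda_{1,p}(\Omega)=\left(\frac{\pi}{2R}\right)^2=\lambda_{1,\infty}(\Omega).$$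
   Context: A domain is a nonempty connected open set; $\Omega^c=\mathbb{R}^n\setminus\Omega$ is assumed nonempty and the maximum defining $R$ is assumed to exist (in particular $R<\infty$). Let $S^{n\times n}$ be the set of real symmetric $n\times n$ matrices. Write $Lu=F(u,\nabla u,D^2u)$ with $F:\mathbb{R}\times(\mathbb{R}^n\setminus\{0\})\times S^{n\times n}\to\mathbb{R}$. For the homogeneous infinity laplacian, $F(s,q,Y)=|q|^{-2}\,q^tYq$; for the homogeneous $p$-laplacian, $F(s,q,Y)=\frac{p-2}{p}|q|^{-2}\,q^tYq+\frac1p\operatorname{tr}(Y)$. The lower semicontinuous envelope is $F_*(s,q,Y)=\liminf_{(r,\xi,X)\to(s,q,Y)}F(r,\xi,X)$, defined also for $q=0$. For a continuous $v:\Omega\to\mathbb{R}$, ''$Lv+\lambda v\le 0$ in $\Omega$ in the viscosity sense'' means that for every $x\in\Omega$ and every $\psi\in C^2$ that touches $v$ at $x$ strictly from below (i.e. $\psi(x)=v(x)$ and $\psi<v$ at all other points of a neighborhood of $x$), one has $F_*(\psi(x),\nabla\psi(x),D^2\psi(x))+\lambda\psi(x)\le 0$. Principal eigenvalue of $-L$: $$\lambda_1(\Omega)=\sup\{\lambda\in\mathbb{R}:\ \exists\, v\in C(\Omega)\text{ with } v(x)>0\ \forall x\in\Omega\text{ and } Lv+\lambda v\le 0 \text{ in }\Omega\text{ in the viscosity sense}\}.$$ *)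

(* Defs.v *)
From HB Require Import structures.
From mathcomp Require Import all_boot all_order all_algebra.
From mathcomp Require Import all_classical all_reals all_analysis.

Set Implicit Arguments.
Unset Strict Implicit.
Unset Printing Implicit Defensive.

Import Order.TTheory GRing.Theory Num.Theory.
Import numFieldTopology.Exports numFieldNormedType.Exports.

Local Open Scope classical_set_scope.
Local Open Scope ring_scope.

(* Points of R^n are row vectors 'rV[R]_n. The library norm
   on 'rV[R]_n is the sup norm: it is used only through its topology, and all
   metric notions below use the Euclidean norm. *)

Definition edot (R : realType) (n : nat) (x y : 'rV[R]_n) : R :=
  (x *m y^T) 0 0.

Definition enorm (R : realType) (n : nat) (x : 'rV[R]_n) : R :=
  Num.sqrt (edot x x).

Definition edist_to (R : realType) (n : nat) (A : set 'rV[R]_n)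
    (x : 'rV[R]_n) : R :=
  inf [set enorm (x - y) | y in A].

Definition domain (R : realType) (n : nat) (Omega : set 'rV[R]_n) : Prop :=
  [/\ Omega !=set0, open Omega & connected Omega].

Definition is_max (R : realType) (A : set R) (m : R) : Prop :=
  A m /\ ubound A m.

Definition grad (R : realType) (n : nat) (f : 'rV[R]_n -> R)
    (x : 'rV[R]_n) : 'rV[R]_n :=
  \row_j 'D_('e_j) f x.

Definition hess (R : realType) (n : nat) (f : 'rV[R]_n -> R)
    (x : 'rV[R]_n) : 'M[R]_n :=
  \matrix_(i, j) 'D_('e_i) ('D_('e_j) f) x.

Definition C2_on (R : realType) (n : nat) (U : set 'rV[R]_n)
    (f : 'rV[R]_n -> R) : Prop :=
  forall x, U x ->
  [/\ {for x, continuous f},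
      forall j : 'I_n, derivable f x 'e_j /\ {for x, continuous ('D_('e_j) f)}
    & forall i j : 'I_n, derivable ('D_('e_j) f) x 'e_i /\
        {for x, continuous ('D_('e_i) ('D_('e_j) f))}].

(* An operator Lu = F(u, grad u, D^2 u) is given by F s q Y; the values of F at
   q = 0 or at a non-symmetric Y are junk and never used. *)
Definition operator (R : realType) (n : nat) : Type :=
  R -> 'rV[R]_n -> 'M[R]_n -> R.

Definition inf_laplacian (R : realType) (n : nat) : operator R n :=
  fun _ q Y => (enorm q ^+ 2)^-1 * (q *m Y *m q^T) 0 0.

Definition p_laplacian (R : realType) (n : nat) (p : R) : operator R n :=
  fun _ q Y =>
    (p - 2) / p * (enorm q ^+ 2)^-1 * (q *m Y *m q^T) 0 0 + p^-1 * \tr Y.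

(* The liminf defining F_* at (s, q, Y) runs over (r, xi, X) with xi != 0 and X
   symmetric (xi = q, X = Y allowed when q != 0), also when q = 0. *)
Definition lsc_env (R : realType) (n : nat) (F : operator R n)
    (s : R) (q : 'rV[R]_n) (Y : 'M[R]_n) : \bar R :=
  limf_einf (fun z : R * 'rV[R]_n * 'M[R]_n => (F z.1.1 z.1.2 z.2)%:E)
    (within [set z | z.1.2 != 0 /\ z.2^T = z.2] (nbhs (s, q, Y))).

Definition touches_below (R : realType) (n : nat) (v psi : 'rV[R]_n -> R)
    (x : 'rV[R]_n) : Prop :=
  psi x = v x /\ \forall y \near x, y != x -> psi y < v y.

(* L v + lambda v <= 0 in Omega in the viscosity sense. Only the values of v on
   the open set Omega matter; test functions are C^2 around the contact point. *)
Definition visc_super (R : realType) (n : nat) (F : operator R n)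
    (lambda : R) (Omega : set 'rV[R]_n) (v : 'rV[R]_n -> R) : Prop :=
  forall (x : 'rV[R]_n) (psi : 'rV[R]_n -> R) (U : set 'rV[R]_n),
    Omega x -> open_nbhs x U -> C2_on U psi -> touches_below v psi x ->
    (lsc_env F (psi x) (grad psi x) (hess psi x) + (lambda * psi x)%:E <= 0)%E.

Definition lambda1 (R : realType) (n : nat) (F : operator R n)
    (Omega : set 'rV[R]_n) : \bar R :=
  ereal_sup [set lambda%:E | lambda in [set lambda : R |
    exists v : 'rV[R]_n -> R,
      [/\ {within Omega, continuous v},
          forall x, Omega x -> 0 < v x
        & visc_super F lambda Omega v]]].

(* Main.v *)
Require Import Defs.
From HB Require Import structures.
From mathcomp Require Import all_boot all_order all_algebra.
From mathcomp Require Import all_classical all_reals all_analysis.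
From mathcomp Require Import ring lra.
Import Order.TTheory GRing.Theory Num.Theory.
Import numFieldTopology.Exports numFieldNormedType.Exports.
Local Open Scope classical_set_scope.
Local Open Scope ring_scope.

Set Implicit Arguments.
Unset Strict Implicit.
Unset Printing Implicit Defensive.

(** Both operators belong to one family: with [th = 1 / p], or [th = 0] for the
    infinity laplacian, the operator is
      [F_th (q, Y) = (1 - 2 th) (q Y q^T) / |q|^2 + th tr Y].
    Writing [b = pi / (2 rho)], it suffices to show that for every [l > b^2]
    (resp. [l < b^2]) the principal eigenvalue of [F_th] is at most (resp. at least)
    [l] for all small [th >= 0], zero included ([lambda1_upper], [lambda1_lower]).

    Upper bound. A ball of radius [r < rho], with [r] as close to [rho] as needed, lies
    in [Omega]. Take [a > b] close to [b] with [a r > pi / 2]. The radial function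
    [w = cos (a |x - x0|) - cos (a r)] vanishes on the boundary of the ball, and
    [F_0 w + a^2 w = - a^2 cos (a r) > 0]; the terms in [th] are bounded, so the sign
    persists for small [th]. If [v] is a positive supersolution for [lam], a
    multiple of [w] touches [v] from below inside the ball, at a maximum of [w / v],
    so that [lam < a^2] ([visc_super_lt]). The test functions are quadratic
    polynomials just below [w] ([cos_radial_test]).

    Lower bound. Let [d] be the distance to the complement and [a < b]. The barrier is
    the minimum of [sin (a (d + eta))] and of a multiple of [sqrt d]
    ([barrier_visc_super]). If [psi] touches it from below at [x], and [y] is a point
    of the complement nearest to [x], then [psi] touches from below the radial
    function obtained by replacing [d] with the distance to [y], so its gradient and
    Hessian are controlled by those of that function ([radial_touch]). The square
    root is needed for [th > 0] only: near the boundary its very negative second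
    derivative dominates the tangential curvature term [th (n - 1) g' / d].

    Comparing Hessians uses the second-order Taylor expansion of [C^2] functions
    along lines ([C2_taylor]) and, because the envelope runs over symmetric
    matrices, Schwarz's theorem ([hess_sym]). *)

(** * Euclidean geometry of row vectors *)

Section Euclidean.
Context {R : realType} {n : nat}.
Implicit Types (x y z : 'rV[R]_n) (k : R) (A : 'M[R]_n).

Lemma edotE x y : edot x y = \sum_i x 0 i * y 0 i.
Proof. by rewrite /edot mxE; apply: eq_bigr => i _; rewrite mxE. Qed.

Lemma edotC x y : edot x y = edot y x.
Proof. by rewrite !edotE; apply: eq_bigr => i _; rewrite mulrC. Qed.

Lemma edotDl x y z : edot (x + y) z = edot x z + edot y z.
Proof. by rewrite /edot mulmxDl mxE. Qed.

Lemma edotDr x y z : edot z (x + y) = edot z x + edot z y.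
Proof. by rewrite edotC edotDl !(edotC z). Qed.

Lemma edotZl k x y : edot (k *: x) y = k * edot x y.
Proof. by rewrite /edot -scalemxAl mxE. Qed.

Lemma edotZr k x y : edot x (k *: y) = k * edot x y.
Proof. by rewrite edotC edotZl edotC. Qed.

Lemma edotNl x y : edot (- x) y = - edot x y.
Proof. by rewrite -scaleN1r edotZl mulN1r. Qed.

Lemma edotNr x y : edot x (- y) = - edot x y.
Proof. by rewrite edotC edotNl edotC. Qed.

Lemma edotBl x y z : edot (x - y) z = edot x z - edot y z.
Proof. by rewrite edotDl edotNl. Qed.

Lemma edot0l y : edot 0 y = 0.
Proof. by rewrite /edot mul0mx mxE. Qed.

Lemma edot0r y : edot y 0 = 0.
Proof. by rewrite edotC edot0l. Qed.

Lemma edot_delta x i : edot x 'e_i = x 0 i.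
Proof.
rewrite edotE (bigD1 i)//= mxE !eqxx mulr1 big1 ?addr0// => j ji.
by rewrite mxE (negbTE ji) andbF mulr0.
Qed.

Lemma edot_ge0 x : 0 <= edot x x.
Proof. by rewrite edotE sumr_ge0// => i _; rewrite -expr2 sqr_ge0. Qed.

Lemma enorm_ge0 x : 0 <= enorm x.
Proof. exact: sqrtr_ge0. Qed.

Lemma enorm_sqr x : enorm x ^+ 2 = edot x x.
Proof. by rewrite /enorm sqr_sqrtr// edot_ge0. Qed.

Lemma edot_eq0 x : (edot x x == 0) = (x == 0).
Proof.
apply/eqP/eqP => [/eqP|->]; last exact: edot0l.
rewrite edotE psumr_eq0; last by move=> i _; rewrite -expr2 sqr_ge0.
move=> /allP x0; apply/rowP => i; rewrite mxE; apply/eqP.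
by have := x0 i (mem_index_enum i); rewrite mulf_eq0 orbb.
Qed.

Lemma enorm_eq0 x : (enorm x == 0) = (x == 0).
Proof. by rewrite -edot_eq0 -enorm_sqr sqrf_eq0. Qed.

Lemma enorm_gt0 x : (0 < enorm x) = (x != 0).
Proof. by rewrite lt0r enorm_eq0 enorm_ge0 andbT. Qed.

Lemma enorm0 : enorm (0 : 'rV[R]_n) = 0.
Proof. by apply/eqP; rewrite enorm_eq0. Qed.

Lemma enormZ k x : enorm (k *: x) = `|k| * enorm x.
Proof.
rewrite {1}/enorm edotZl edotZr mulrA -expr2 sqrtrM ?sqr_ge0// sqrtr_sqr.
by [].
Qed.

Lemma enormN x : enorm (- x) = enorm x.
Proof. by rewrite -scaleN1r enormZ normrN1 mul1r. Qed.

Lemma enorm_distC x y : enorm (x - y) = enorm (y - x).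
Proof. by rewrite -enormN opprB. Qed.

Lemma enormD_sqr x y :
  enorm (x + y) ^+ 2 = enorm x ^+ 2 + 2 * edot x y + enorm y ^+ 2.
Proof.
by rewrite !enorm_sqr edotDl !edotDr (edotC y x); ring.
Qed.

Lemma cauchy_schwarz x y : `|edot x y| <= enorm x * enorm y.
Proof.
have [->|y0] := eqVneq y 0; first by rewrite edot0r normr0 enorm0 mulr0.
have yy : 0 < enorm y ^+ 2 by rewrite exprn_gt0// enorm_gt0.
have := edot_ge0 ((enorm y ^+ 2) *: x - edot x y *: y).
rewrite edotBl !(edotZl, edotC _ (_ - _), edotBl) -!enorm_sqr (edotC y x).
set b := edot x y; set X := enorm x; set Y := enorm y in yy * => H.
have {}H : 0 <= Y ^+ 2 * (Y ^+ 2 * X ^+ 2 - b ^+ 2).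
  by move: H; congr (_ <= _); ring.
rewrite -(@ler_pXn2r _ 2) ?nnegrE ?mulr_ge0 ?enorm_ge0// real_normK ?num_real//.
by move: H; rewrite pmulr_rge0// exprMn mulrC subr_ge0 mulrC.
Qed.

Lemma ler_enormD x y : enorm (x + y) <= enorm x + enorm y.
Proof.
rewrite -(@ler_pXn2r _ 2) ?nnegrE ?addr_ge0 ?enorm_ge0// enormD_sqr.
have := le_trans (ler_norm _) (cauchy_schwarz x y).
set X := enorm x; set Y := enorm y => H.
by rewrite sqrrD mulr_natl lerD2r lerD2l lerMn2r H orbT.
Qed.

Lemma ler_enorm_dist x y : `|enorm (x + y) - enorm x| <= enorm y.
Proof.
have := ler_enormD x y; have := ler_enormD (x + y) (- y).
rewrite addrK enormN ler_norml => *; apply/andP; split; lra.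
Qed.

Lemma coord_le_enorm x i : `|x 0 i| <= enorm x.
Proof.
rewrite -(@ler_pXn2r _ 2) ?nnegrE ?enorm_ge0// real_normK ?num_real//.
rewrite enorm_sqr edotE (bigD1 i)//= -expr2 lerDl sumr_ge0// => j _.
by rewrite -expr2 sqr_ge0.
Qed.

Lemma mxnorm_le_enorm x : `|x| <= enorm x.
Proof.
rewrite {1}/Num.Def.normr/= mx_normrE; apply: bigmax_le; first exact: enorm_ge0.
by move=> -[i j] _; rewrite ord1 coord_le_enorm.
Qed.

Lemma mx_coord_le (p q : nat) (A : 'M[R]_(p, q)) i j : `|A i j| <= `|A|.
Proof.
rewrite [leRHS]/Num.Def.normr/= mx_normrE.
exact: (le_bigmax _ (fun ij : 'I_p * 'I_q => `|A ij.1 ij.2|) (i, j)).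
Qed.

Lemma enorm_le_mxnorm x : enorm x <= n%:R * `|x|.
Proof.
rewrite -(@ler_pXn2r _ 2) ?nnegrE ?mulr_ge0 ?enorm_ge0// enorm_sqr edotE.
rewrite (@le_trans _ _ (\sum_(i < n) `|x| ^+ 2))//.
  apply: ler_sum => i _; rewrite -expr2 -real_normK ?num_real//.
  by rewrite ler_pXn2r ?nnegrE// mx_coord_le.
rewrite sumr_const card_ord -[leLHS]mulr_natl exprMn ler_wpM2r ?sqr_ge0//.
by rewrite -natrX ler_nat; case: (n) => // k; rewrite -mulnn leq_pmulr.
Qed.

(** Euclidean balls form a basis of neighbourhoods for the topology of the
    sup norm. *)
Lemma near_enormP x (P : set 'rV[R]_n) :
  (\forall y \near x, P y) <->
  exists2 r, 0 < r & forall z, enorm z < r -> P (x + z).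
Proof.
split=> [/nbhs_ballP[r /= r0 H]|[r r0 H]].
  exists r => // z zr; apply: H; rewrite -ball_normE/= opprD addNKr normrN.
  exact: le_lt_trans (mxnorm_le_enorm z) zr.
apply/nbhs_ballP; exists (r / (n%:R + 1)); first by rewrite /= divr_gt0// ltr_wpDl.
move=> y; rewrite -ball_normE/= distrC => xy.
rewrite -(subrK x y) addrC; apply: H.
apply: le_lt_trans (enorm_le_mxnorm _) _.
rewrite (@le_lt_trans _ _ ((n%:R + 1) * `|y - x|)) ?ler_wpM2r ?lerDl//.
by move: xy; rewrite ltr_pdivlMr ?ltr_wpDl// mulrC.
Qed.

Lemma continuous_enormB x0 : continuous (fun x => enorm (x - x0)).
Proof.
move=> x; apply/(cvgrPdist_lt (FF := nbhs_filter x)) => e e0.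
apply/near_enormP; exists e => // z ze.
rewrite addrAC distrC; apply: le_lt_trans ze; exact: ler_enorm_dist.
Qed.

(** The closed Euclidean balls are compact. *)
Lemma compact_eball x0 r : compact [set x | enorm (x - x0) <= r].
Proof.
apply: bounded_closed_compact.
  exists (r + `|x0|); split; first exact: num_real.
  move=> M rM x /= xr; rewrite -(subrK x0 x); apply: le_trans (ltW rM).
  by rewrite (le_trans (ler_normD _ _))// lerD2r (le_trans (mxnorm_le_enorm _)).
have -> : [set x | enorm (x - x0) <= r] =
    (fun x => enorm (x - x0)) @^-1` [set t | t <= r] by [].
apply: preimage_closed; last exact: closed_le.
by move=> x _; exact: continuous_enormB.
Qed.

End Euclidean.

(** * Second-order calculus *)

Section Derivatives.
Context {R : realType}.

(** The derivative of [f] along [v], as a first-order expansion. *)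
Lemma is_derive_epsP (V : normedModType R) (f : V -> R) (x v : V) (df : R) :
  is_derive x v f df <->
  forall e, 0 < e -> exists2 r, 0 < r & forall h, `|h| < r ->
    `|f (x + h *: v) - f x - h * df| <= e * `|h|.
Proof.
have eqh (h : R) : h != 0 -> `|df - h^-1 *: ((f \o shift x) (h *: v) - f x)| =
    `|f (x + h *: v) - f x - h * df| / `|h|.
  move=> h0; rewrite /= -normfV -normrM distrC; congr `|_|.
  by rewrite (addrC (h *: v)) /GRing.scale/=; field.
split=> [[fx dfE] e e0|H].
  have : h^-1 *: ((f \o shift x) (h *: v) - f x) @[h --> 0^'] --> df.
    by rewrite -dfE; exact: fx.
  move=> /cvgrPdist_le /(_ e e0) /nbhs_ballP[r /= r0 Hr].
  exists r => // h hr; have [->|h0] := eqVneq h 0.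
    by rewrite scale0r addr0 subrr mul0r subr0 normr0 mulr0.
  rewrite -ler_pdivrMr ?normr_gt0// -eqh//; apply: Hr => //.
  by rewrite -ball_normE/= sub0r normrN.
have cv : h^-1 *: ((f \o shift x) (h *: v) - f x) @[h --> 0^'] --> df.
  apply/cvgrPdist_le => e e0; have [r r0 Hr] := H e e0.
  apply/nbhs_ballP; exists r => // h; rewrite -ball_normE/= sub0r normrN => hr h0.
  by rewrite eqh// ler_pdivrMr ?normr_gt0// Hr.
split; first by apply/cvg_ex; exists df.
exact: cvg_lim cv.
Qed.

(** The derivative of [f] at a point of the line through [x] of direction [v]
    is the derivative of its restriction to that line. *)
Lemma is_derive_line (V : normedModType R) (f : V -> R) (x v : V) (t df : R) :
  is_derive (x + t *: v) v f df <->
  is_derive t 1 (fun s => f (x + s *: v)) df.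
Proof.
split=> /is_derive_epsP H; apply/is_derive_epsP => e /H[r r0 Hr]; exists r => // h.
- by move=> /Hr; rewrite [h *: 1]mulr1 scalerDl addrA.
- by move=> /Hr; rewrite [h *: 1]mulr1 scalerDl addrA.
Qed.

Lemma is_derive1_continuous (f : R -> R) (x df : R) :
  is_derive x 1 f df -> {for x, continuous f}.
Proof. by case=> fx _; apply/differentiable_continuous/derivable1_diffP. Qed.

(** Mean value theorem, the endpoints in either order. *)
Lemma MVT_abs (f df : R -> R) (t : R) :
  (forall s : R, `|s| <= `|t| -> is_derive s 1 f (df s)) ->
  exists2 s, `|s| <= `|t| & f t - f 0 = df s * t.
Proof.
move=> fdf; have [t0|t0] := leP 0 t.
  have [||s] := @MVT_segment R f df 0 t t0.
  - move=> s; rewrite in_itv/= => /andP[s0 st]; apply: fdf.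
    by rewrite !ger0_norm// ltW.
  - apply/continuous_in_subspaceT => s; rewrite inE/= in_itv/= => /andP[s0 st].
    by apply: is_derive1_continuous (fdf s _); rewrite !ger0_norm.
  rewrite in_itv/= subr0 => /andP[s0 st] ->; exists s => //.
  by rewrite !ger0_norm.
have [||s] := @MVT_segment R f df t 0 (ltW t0).
- move=> s; rewrite in_itv/= => /andP[s0 st]; apply: fdf.
  by rewrite !ler0_norm ?lerN2// ltW.
- apply/continuous_in_subspaceT => s; rewrite inE/= in_itv/= => /andP[s0 st].
  by apply: is_derive1_continuous (fdf s _); rewrite !ler0_norm ?lerN2// ltW.
rewrite in_itv/= sub0r => /andP[s0 st] H; exists s.
  by rewrite !ler0_norm ?lerN2// ltW.
by rewrite -opprB H mulrN opprK.
Qed.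

(** Second-order Taylor formula with Peano remainder. *)
Lemma taylor2 (f f1 : R -> R) (t m : R) :
  (\forall s \near t, is_derive (s : R) 1 f (f1 s)) -> is_derive t 1 f1 m ->
  forall e, 0 < e -> exists2 r, 0 < r & forall h, `|h| < r ->
    `|f (t + h) - (f t + f1 t * h + m / 2 * h ^+ 2)| <= e * h ^+ 2.
Proof.
move=> /nbhs_ballP[r1 /= r10 f1P] /is_derive_epsP mP e e0.
have [r2 r20 {}mP] := mP e e0.
exists (Num.min r1 r2); first by rewrite lt_min r10.
move=> h; rewrite lt_min => /andP[hr1 hr2].
pose g s := f (t + s) - (f1 t * s + m / 2 * s ^+ 2).
pose dg s := f1 (t + s) - (f1 t + m * s).
have gdg (s : R) : `|s| <= `|h| -> is_derive s 1 g (dg s).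
  move=> sh; have fs : is_derive s 1 (fun s => f (t + s)) (f1 (t + s)).
    have -> : (fun s => f (t + s)) = (fun s => f (t + s *: (1 : R))).
      by apply/funext => u; rewrite [u *: _]mulr1.
    apply/(is_derive_line f t 1 s); rewrite [s *: _]mulr1; apply: f1P.
    by rewrite -ball_normE/= opprD addNKr normrN (le_lt_trans sh).
  apply: is_derive_eq; rewrite /dg; congr (_ - _).
  by rewrite /GRing.scale/=; field.
have [s sh] := MVT_abs gdg.
rewrite /g addr0 mulr0 expr0n/= mulr0 addr0 subr0 => gh.
rewrite (_ : _ - _ = dg s * h); last by rewrite -gh; ring.
rewrite normrM -(real_normK (num_real h)) expr2 mulrA ler_wpM2r//.
have := mP s (le_lt_trans sh hr2); rewrite [s *: _]mulr1 => H.
rewrite /dg opprD addrA (mulrC m) (le_trans H)// ler_wpM2l// ltW//.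
Qed.

End Derivatives.

Section Partial.
Context {R : realType} {n : nat}.
Implicit Types (x y z q : 'rV[R]_n) (Y : 'M[R]_n) (U : set 'rV[R]_n).

(** The quadratic form [z Y z^T]. *)
Definition qform Y z : R := edot (z *m Y) z.

Lemma qformE Y z : (z *m Y *m z^T) 0 0 = qform Y z.
Proof. by []. Qed.

Lemma qform_sum Y z : qform Y z = \sum_j z 0 j * \sum_i z 0 i * Y i j.
Proof.
by rewrite /qform edotE; apply: eq_bigr => j _; rewrite mxE mulrC.
Qed.

Lemma mx_norm_le (p k : nat) (A : 'M[R]_(p, k)) (e : R) : 0 <= e ->
  (forall i j, `|A i j| <= e) -> `|A| <= e.
Proof.
move=> e0 H; rewrite [leLHS]/Num.Def.normr/= mx_normrE bigmax_le// => -[i j].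
Qed.

(** A function with partial derivatives that exist near [x] and are continuous
    at [x] has all directional derivatives at [x], given by the gradient: move
    from [x] to [x + h z] one coordinate at a time and use the mean value
    theorem on each segment. *)
Lemma is_derive_partial (f : 'rV[R]_n -> R) (df : 'I_n -> 'rV[R]_n -> R) x z :
  (\forall y \near x, forall j, is_derive y 'e_j f (df j y)) ->
  (forall j, {for x, continuous (df j)}) ->
  is_derive x z f (\sum_j z 0 j * df j x).
Proof.
move=> fdf cdf; apply/is_derive_epsP => e e0.
pose S := 1 + \sum_j `|z 0 j|.
have S0 : 0 < S by rewrite ltr_wpDr// sumr_ge0.
have eS : 0 < e / S by rewrite divr_gt0.
have : \forall y \near x, forall j, `|df j x - df j y| <= e / S.
  apply: (filter_forall (nbhs_filter x)) => j; have := cdf j.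
  by move=> /(cvgrPdist_le (FF := nbhs_filter x)) /(_ _ eS).
move=> cont_near.
have /nbhs_ballP[r /= r0 Hr] : nbhs x [set y |
    (forall j, is_derive y 'e_j f (df j y)) /\
    (forall j, `|df j x - df j y| <= e / S)].
  exact: (@filterI _ _ (nbhs_filter x) _ _ fdf cont_near).
exists (r / (1 + `|z|)); first by rewrite divr_gt0// ltr_wpDr.
move=> h hr.
(* [P k] has its first [k] coordinates moved. *)
pose P (k : nat) : 'rV[R]_n := x + h *: \row_j (if (j < k)%N then z 0 j else 0).
have Pn : P n = x + h *: z.
  by rewrite /P; congr (_ + _ *: _); apply/rowP => j; rewrite mxE ltn_ord.
have P0 : P 0%N = x.
  by rewrite /P (_ : \row_j _ = 0) ?scaler0 ?addr0//; apply/rowP => j; rewrite !mxE.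
have PS (k : 'I_n) : P k.+1 = P k + (h * z 0 k) *: 'e_k.
  rewrite /P -scalerA -addrA -scalerDr; congr (_ + _ *: _); apply/rowP => j.
  rewrite !mxE eqxx/= ltnS leq_eqVlt; have [->|jk] := eqVneq j k.
    by rewrite ltnn eqxx/= mulr1 add0r.
  by rewrite (negbTE (_ : (j : nat) != k))//= mulr0 addr0.
have Pball (k : 'I_n) (s : R) : `|s| <= `|h * z 0 k| ->
    ball x r (P k + s *: 'e_k).
  move=> sh; rewrite -ball_normE/= /P opprD opprD !addrA subrr sub0r -opprD normrN.
  apply: (@le_lt_trans _ _ (`|h| * `|z|)); last first.
    rewrite (@le_lt_trans _ _ (`|h| * (1 + `|z|))) ?ler_wpM2l ?lerDr//.
    by rewrite -ltr_pdivlMr// ltr_wpDr.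
  apply: mx_norm_le => [|i j]; first by rewrite mulr_ge0.
  rewrite ord1 !mxE eqxx/=; have [->|jk] := eqVneq j k.
    rewrite ltnn mulr0 add0r mulr1 (le_trans sh)// normrM ler_wpM2l//.
    exact: mx_coord_le.
  rewrite mulr0 addr0 normrM ler_wpM2l//; case: ifP => _.
    exact: mx_coord_le.
  by rewrite normr0.
have step (k : 'I_n) :
    `|f (P k.+1) - f (P k) - h * (z 0 k * df k x)| <= `|h| * (`|z 0 k| * (e / S)).
  pose g s := f (P k + s *: 'e_k).
  have gd (s : R) : `|s| <= `|h * z 0 k| ->
      is_derive s 1 g (df k (P k + s *: 'e_k)).
    move=> sh; apply/(is_derive_line f (P k) 'e_k s).
    by have [/(_ k)] := Hr _ (Pball _ _ sh).
  have [s sh] := MVT_abs gd; rewrite /g scale0r addr0 -PS => ->.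
  rewrite (_ : _ - _ = h * z 0 k * (df k (P k + s *: 'e_k) - df k x)); last by ring.
  rewrite 2!normrM -mulrA !ler_wpM2l// distrC.
  by have [_ /(_ k)] := Hr _ (Pball _ _ sh).
rewrite -Pn -[X in _ - f X - _]P0 -(telescope_sumr (f \o P) (leq0n n)).
rewrite big_mkord mulr_sumr -sumrB (le_trans (ler_norm_sum _ _ _))//.
apply: le_trans (ler_sum _ (fun k _ => step k)) _.
rewrite -mulr_sumr -mulr_suml mulrC ler_wpM2r// mulrCA ler_piMr ?ltW//.
by rewrite ltr_pdivrMr// mul1r /S ltrDr.
Qed.

End Partial.

Section C2Functions.
Context {R : realType} {n : nat}.
Implicit Types (x y z q : 'rV[R]_n) (Y : 'M[R]_n) (U : set 'rV[R]_n).

Lemma C2_on_is_derive U (psi : 'rV[R]_n -> R) y z : open U -> C2_on U psi -> U y ->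
  is_derive y z psi (\sum_j z 0 j * 'D_('e_j) psi y).
Proof.
move=> oU C2 Uy.
apply: (is_derive_partial (df := fun j => 'D_('e_j) psi)); last first.
  by move=> j; have [_ /(_ j)[]] := C2 y Uy.
apply: filterS (_ : nbhs y U); last exact: open_nbhs_nbhs.
move=> w Uw j; apply: derivableP.
by have [_ /(_ j)[]] := C2 w Uw.
Qed.

Lemma C2_on_is_derive2 U (psi : 'rV[R]_n -> R) y z j : open U -> C2_on U psi -> U y ->
  is_derive y z ('D_('e_j) psi) (\sum_i z 0 i * 'D_('e_i) ('D_('e_j) psi) y).
Proof.
move=> oU C2 Uy.
apply: (is_derive_partial (df := fun i => 'D_('e_i) ('D_('e_j) psi))); last first.
  by move=> i; have [_ _ /(_ i j)[]] := C2 y Uy.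
apply: filterS (_ : nbhs y U); last exact: open_nbhs_nbhs.
move=> w Uw i; apply: derivableP.
by have [_ _ /(_ i j)[]] := C2 w Uw.
Qed.

Lemma near_line x z (P : set 'rV[R]_n) : (\forall y \near x, P y) ->
  exists2 r, 0 < r & forall t : R, `|t| < r -> P (x + t *: z).
Proof.
move=> /near_enormP[r r0 H]; exists (r / (1 + enorm z)).
  by rewrite divr_gt0// ltr_wpDr// enorm_ge0.
move=> t tr; apply: H; rewrite enormZ.
rewrite (@le_lt_trans _ _ (`|t| * (1 + enorm z))) ?ler_wpM2l ?lerDr//.
by rewrite -ltr_pdivlMr// ltr_wpDr// enorm_ge0.
Qed.

Lemma C2_taylor U (psi : 'rV[R]_n -> R) x z : open U -> C2_on U psi -> U x ->
  forall e, 0 < e -> exists2 r, 0 < r & forall t : R, `|t| < r ->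
    `|psi (x + t *: z) - (psi x + edot (grad psi x) z * t +
       qform (hess psi x) z / 2 * t ^+ 2)| <= e * t ^+ 2.
Proof.
move=> oU C2 Ux e e0.
pose f (t : R) := psi (x + t *: z).
pose f1 (t : R) := \sum_j z 0 j * 'D_('e_j) psi (x + t *: z).
have ff1 : \forall s \near (0 : R), is_derive (s : R) 1 f (f1 s).
  have [|r r0 H] := @near_line x z U; first exact: open_nbhs_nbhs.
  apply/nbhs_ballP; exists r => // s; rewrite -ball_normE/= sub0r normrN => /H Us.
  apply/(is_derive_line psi x z s); exact: C2_on_is_derive Us.
have f12 : is_derive (0 : R) 1 f1 (qform (hess psi x) z).
  rewrite qform_sum; under eq_bigr do under eq_bigr do rewrite mxE.
  have dj (j : 'I_n) : is_derive (0 : R) 1 (fun t : R => 'D_('e_j) psi (x + t *: z))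
      (\sum_i z 0 i * 'D_('e_i) ('D_('e_j) psi) x).
    apply/(is_derive_line ('D_('e_j) psi) x z 0); rewrite scale0r addr0.
    exact: C2_on_is_derive2 Ux.
  have -> : f1 = \sum_j (fun t : R => z 0 j *: 'D_('e_j) psi (x + t *: z)).
    by apply/funext => t; rewrite fct_sumE.
  by apply: is_derive_sum => j; apply: is_deriveZ.
have [r r0 H] := taylor2 ff1 f12 e0; exists r => // t /H.
rewrite /f /f1 add0r scale0r addr0; congr (`|_ - (_ + _ * _ + _)| <= _).
by rewrite edotE; apply: eq_bigr => j _; rewrite mxE mulrC.
Qed.

(** The mixed second difference of [psi], divided by [t ^ 2], tends to the mixed
    derivative at [x]: by the mean value theorem, used twice, it is a value of that
    derivative at a point that tends to [x]. *)
Lemma mixed_difference U (psi : 'rV[R]_n -> R) x i j : open U -> C2_on U psi -> U x ->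
  forall e, 0 < e -> exists2 r, 0 < r & forall t : R, 0 < t < r ->
    `|psi (x + t *: 'e_j + t *: 'e_i) - psi (x + t *: 'e_j) -
      psi (x + t *: 'e_i) + psi x - hess psi x i j * t ^+ 2| <= e * t ^+ 2.
Proof.
move=> oU C2 Ux e e0.
have Unear : nbhs x U by apply: open_nbhs_nbhs.
have Hnear : nbhs x [set y | `|'D_('e_i) ('D_('e_j) psi) x -
    'D_('e_i) ('D_('e_j) psi) y| <= e].
  have [_ _ /(_ i j)[_]] := C2 x Ux.
  by move=> /(cvgrPdist_le (FF := nbhs_filter x)) /(_ _ e0).
have /nbhs_ballP[r /= r0 Hr] := @filterI _ _ (nbhs_filter x) _ _ Unear Hnear.
exists (r / 2); first by rewrite divr_gt0.
move=> t /andP[t0 tr].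
have near_x (s u : R) : `|s| <= `|t| -> `|u| <= `|t| ->
    ball x r (x + s *: 'e_j + u *: 'e_i).
  rewrite (gtr0_norm t0) => st ut.
  rewrite -ball_normE/= -addrA opprD addNKr normrN.
  rewrite (le_lt_trans (ler_normD _ _))//.
  have n1 (k : 'I_n) : `|'e_k : 'rV[R]_n| <= 1.
    apply: mx_norm_le => // a b; rewrite mxE.
    by case: (_ && _); rewrite ?normr1 ?normr0.
  have sj : `|s *: ('e_j : 'rV[R]_n)| <= t.
    by rewrite normrZ (le_trans _ st)// ler_piMr.
  have ui : `|u *: ('e_i : 'rV[R]_n)| <= t.
    by rewrite normrZ (le_trans _ ut)// ler_piMr.
  by rewrite (le_lt_trans (lerD sj ui))// -[t]mulr1 -mulrDr -ltr_pdivlMr.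
pose g (s : R) := psi (x + t *: 'e_i + s *: 'e_j) - psi (x + s *: 'e_j).
pose dg (s : R) := 'D_('e_j) psi (x + t *: 'e_i + s *: 'e_j) -
  'D_('e_j) psi (x + s *: 'e_j).
have gd (s : R) : `|s| <= `|t| -> is_derive s 1 g (dg s).
  move=> st; apply: is_deriveB.
    apply/(is_derive_line psi (x + t *: 'e_i) 'e_j s).
    have [Us _] := Hr _ (near_x s t st (lexx _)); rewrite addrAC.
    by apply: derivableP; have [_ /(_ j)[]] := C2 _ Us.
  apply/(is_derive_line psi x 'e_j s).
  have := near_x s 0 st; rewrite normr0 scale0r addr0 => /(_ (normr_ge0 _)).
  move=> /Hr[Us _].
  by apply: derivableP; have [_ /(_ j)[]] := C2 _ Us.
have [s st gE] := MVT_abs gd.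
pose k (u : R) := 'D_('e_j) psi (x + s *: 'e_j + u *: 'e_i).
have kd (u : R) : `|u| <= `|t| ->
    is_derive u 1 k ('D_('e_i) ('D_('e_j) psi) (x + s *: 'e_j + u *: 'e_i)).
  move=> ut; apply/(is_derive_line ('D_('e_j) psi) (x + s *: 'e_j) 'e_i u).
  have [Us _] := Hr _ (near_x s u st ut).
  by apply: derivableP; have [_ _ /(_ i j)[]] := C2 _ Us.
have [u ut kE] := MVT_abs kd.
have [_ ] := Hr _ (near_x s u st ut); rewrite /= distrC => H.
have -> : psi (x + t *: 'e_j + t *: 'e_i) - psi (x + t *: 'e_j) -
    psi (x + t *: 'e_i) + psi x = g t - g 0.
  by rewrite /g scale0r !addr0 (addrAC x); ring.
have dgE : dg s = k t - k 0 by rewrite /dg /k scale0r addr0 (addrAC x).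
rewrite gE dgE kE mxE (_ : _ - _ = ('D_('e_i) ('D_('e_j) psi)
  (x + s *: 'e_j + u *: 'e_i) - 'D_('e_i) ('D_('e_j) psi) x) * t ^+ 2); last by ring.
by rewrite normrM [X in _ * X]ger0_norm ?sqr_ge0// ler_wpM2r ?sqr_ge0.
Qed.

(** Schwarz's theorem on the symmetry of second derivatives. *)
Lemma hess_sym U (psi : 'rV[R]_n -> R) x : open U -> C2_on U psi -> U x ->
  (hess psi x)^T = hess psi x.
Proof.
move=> oU C2 Ux; apply/matrixP => i j; rewrite [LHS]mxE.
apply/eqP; rewrite -subr_eq0 -normr_le0 leNgt; apply/negP => d0.
set d := `|_| in d0; have e0 : 0 < d / 4 by rewrite divr_gt0.
have [r1 r10 H1] := mixed_difference i j oU C2 Ux e0.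
have [r2 r20 H2] := mixed_difference j i oU C2 Ux e0.
pose t := Num.min r1 r2 / 2.
have t0 : 0 < t by rewrite divr_gt0// lt_min r10.
have tm : t < Num.min r1 r2 by rewrite /t ltr_pdivrMr// ltr_pMr ?lt_min ?r10// ltr1n.
move: tm; rewrite lt_min => /andP[tr1 tr2].
have := H1 t; rewrite t0 tr1 => /(_ isT); have := H2 t; rewrite t0 tr2 => /(_ isT).
rewrite (addrAC x (t *: 'e_i)).
set D := psi (_ + _ + _); set a := psi _; set b := psi _; set c := psi x.
set p := hess psi x j i; set q := hess psi x i j => K1 K2.
have t2 : 0 < t ^+ 2 by rewrite exprn_gt0.
have : d * t ^+ 2 <= d / 2 * t ^+ 2.
  rewrite {1}/d -[X in _ * X <= _](ger0_norm (ltW t2)) -normrM.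
  rewrite (_ : _ * _ = (D - b - a + c - q * t ^+ 2) - (D - a - b + c - p * t ^+ 2)).
    rewrite (le_trans (ler_normB _ _))//; move: K1 K2; lra.
  by rewrite /p /q; ring.
by rewrite ler_pM2r//; lra.
Qed.

End C2Functions.

Section Quadratic.
Context {R : realType} {n : nat}.
Implicit Types (x y z q v : 'rV[R]_n) (Y : 'M[R]_n).

(** The quadratic polynomial with value [c], gradient [q] and Hessian [Y]
    at [x0]. *)
Definition quadp (c : R) q Y x0 x : R :=
  c + edot q (x - x0) + 2^-1 * qform Y (x - x0).

Lemma qformZ Y (k : R) z : qform Y (k *: z) = k ^+ 2 * qform Y z.
Proof. by rewrite /qform -scalemxAl edotZl edotZr mulrA -expr2. Qed.

Lemma qformDm A B z : qform (A + B) z = qform A z + qform B z.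
Proof. by rewrite /qform mulmxDr edotDl. Qed.

Lemma qformZm (k : R) Y z : qform (k *: Y) z = k * qform Y z.
Proof. by rewrite /qform -scalemxAr edotZl. Qed.

Lemma qformNm Y z : qform (- Y) z = - qform Y z.
Proof. by rewrite /qform mulmxN edotNl. Qed.

Lemma qform_scalar (k : R) z : qform k%:M z = k * enorm z ^+ 2.
Proof. by rewrite /qform mul_mx_scalar edotZl enorm_sqr. Qed.

Lemma qform_rank1 y z : qform (y^T *m y) z = edot y z ^+ 2.
Proof.
rewrite /qform mulmxA.
have -> : z *m y^T = (edot y z)%:M.
  by apply/matrixP => i j; rewrite !ord1 edotC /edot [in RHS]mxE eqxx mulr1n.
by rewrite mul_scalar_mx edotZl expr2.
Qed.

Lemma edot_mulmx_sym Y v z : Y^T = Y -> edot (v *m Y) z = edot (z *m Y) v.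
Proof.
move=> YT; rewrite /edot.
have -> : (z *m Y *m v^T) 0 0 = (z *m Y *m v^T)^T 0 0 by rewrite [RHS]mxE.
by rewrite !trmx_mul trmxK YT mulmxA.
Qed.

Lemma qformD Y v z : Y^T = Y ->
  qform Y (v + z) = qform Y v + 2 * edot (v *m Y) z + qform Y z.
Proof.
move=> YT; rewrite /qform mulmxDl edotDl !edotDr (edot_mulmx_sym z v YT).
by ring.
Qed.

Lemma is_derive_quadp c q Y x0 x v : Y^T = Y ->
  is_derive x v (quadp c q Y x0) (edot (q + (x - x0) *m Y) v).
Proof.
move=> YT; apply/is_derive_epsP => e e0.
pose k := `|qform Y v / 2|.
exists (e / (1 + k)); first by rewrite divr_gt0// ltr_wpDr// normr_ge0.
move=> h; rewrite ltr_pdivlMr ?ltr_wpDr ?normr_ge0// => hk.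
rewrite /quadp (addrAC x) (qformD (x - x0) (h *: v) YT).
rewrite (edotDr (x - x0) (h *: v) q) qformZ !edotZr edotDl.
rewrite (_ : _ - _ = h * (h * (qform Y v / 2))); last by field.
rewrite normrM mulrC ler_wpM2r// normrM -/k (le_trans _ (ltW hk))//.
by rewrite ler_wpM2l// lerDr.
Qed.

Lemma is_derive_affine q Y x0 x v w :
  is_derive x v (fun x => edot (q + (x - x0) *m Y) w) (edot (v *m Y) w).
Proof.
apply/is_derive_epsP => e e0; exists 1 => // h _.
rewrite (addrAC x) mulmxDl -scalemxAl !edotDl edotZl.
rewrite (_ : _ - _ = 0); first by rewrite normr0 mulr_ge0// ltW.
by ring.
Qed.

Lemma continuous_edot (T : topologicalType) (f g : T -> 'rV[R]_n) (t0 : T) :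
  {for t0, continuous f} -> {for t0, continuous g} ->
  {for t0, continuous (fun t => edot (f t) (g t))}.
Proof.
move=> cf cg.
have -> : (fun t => edot (f t) (g t)) = (fun t => \sum_i f t 0 i * g t 0 i).
  by apply/funext => t; rewrite edotE.
apply: (cvg_big add_continuous) => i _; apply: cvgM.
  apply: (@continuous_comp _ _ _ f (fun M : 'rV[R]_n => M 0 i) t0 cf).
  exact: coord_continuous.
apply: (@continuous_comp _ _ _ g (fun M : 'rV[R]_n => M 0 i) t0 cg).
exact: coord_continuous.
Qed.

Lemma continuous_mulmx Y x0 x : {for x, continuous (fun x => (x - x0) *m Y)}.
Proof.
apply/(cvgrPdist_lt (FF := nbhs_filter x)) => e e0.
pose S := 1 + \sum_i \sum_j `|Y i j|.
have S0 : 0 < S by rewrite ltr_wpDr// sumr_ge0// => i _; rewrite sumr_ge0.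
apply/nbhs_ballP; exists (e / S); first by rewrite /= divr_gt0.
move=> y; rewrite -ball_normE/= ltr_pdivlMr// => xy.
rewrite -mulmxBl opprB addrA subrK (le_lt_trans _ xy)//.
apply: mx_norm_le => [|i j]; first by rewrite mulr_ge0// ltW.
rewrite ord1 mxE (le_trans (ler_norm_sum _ _ _))//.
rewrite (@le_trans _ _ (\sum_k `|x - y| * `|Y k j|))//.
  by apply: ler_sum => k _; rewrite normrM ler_wpM2r// mx_coord_le.
rewrite -mulr_sumr ler_wpM2l// /S ler_wpDl// ler_sum// => k _.
by rewrite (bigD1 j)//= lerDl sumr_ge0.
Qed.

Lemma continuous_sub x0 x : {for x, continuous (fun x : 'rV[R]_n => x - x0)}.
Proof. by apply: continuousB; [exact: cvg_id|exact: cst_continuous]. Qed.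

Lemma C2_on_quadp c q Y x0 : Y^T = Y -> C2_on setT (quadp c q Y x0).
Proof.
move=> YT x _.
have D1 (v : 'rV[R]_n) : 'D_v (quadp c q Y x0) = (fun x => edot (q + (x - x0) *m Y) v).
  by apply/funext => y; apply: derive_val; exact: is_derive_quadp.
have D2 (v w : 'rV[R]_n) : 'D_w (fun x => edot (q + (x - x0) *m Y) v) =
    (fun=> edot (w *m Y) v).
  by apply/funext => y; apply: derive_val; exact: is_derive_affine.
split=> [|j|i j].
- apply: continuousD.
    apply: continuousD; first exact: cst_continuous.
    by apply: continuous_edot; [exact: cst_continuous|exact: continuous_sub].
  apply: continuousM; first exact: cst_continuous.
  by apply: continuous_edot; [exact: continuous_mulmx|exact: continuous_sub].
- split; first by have [] := is_derive_quadp c q x0 x 'e_j YT.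
  rewrite D1; apply: continuous_edot; last exact: cst_continuous.
  by apply: continuousD; [exact: cst_continuous|exact: continuous_mulmx].
- rewrite D1 D2; split; last exact: cst_continuous.
  by have [] := is_derive_affine q Y x0 x 'e_i 'e_j.
Qed.

Lemma grad_quadp c q Y x0 : Y^T = Y -> grad (quadp c q Y x0) x0 = q.
Proof.
move=> YT; apply/rowP => j; rewrite mxE.
rewrite (@derive_val _ _ _ _ _ _ _ (is_derive_quadp c q x0 x0 'e_j YT)).
by rewrite subrr mul0mx addr0 edot_delta.
Qed.

Lemma hess_quadp c q Y x0 : Y^T = Y -> hess (quadp c q Y x0) x0 = Y.
Proof.
move=> YT; apply/matrixP => i j; rewrite mxE.
have -> : 'D_('e_j) (quadp c q Y x0) = (fun x => edot (q + (x - x0) *m Y) 'e_j).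
  by apply/funext => y; apply: derive_val; exact: is_derive_quadp.
rewrite (@derive_val _ _ _ _ _ _ _ (is_derive_affine q Y x0 x0 'e_i 'e_j)).
by rewrite edot_delta -rowE mxE.
Qed.

(** Quadratic polynomials are admissible test functions. *)
Lemma visc_super_quad F lam (Om : set 'rV[R]_n) (v : 'rV[R]_n -> R) y q Y :
  visc_super F lam Om v -> Om y -> Y^T = Y ->
  (exists2 r, 0 < r & forall z, z != 0 -> enorm z < r ->
    v y + edot q z + 2^-1 * qform Y z < v (y + z)) ->
  (lsc_env F (v y) q Y + (lam * v y)%:E <= 0)%E.
Proof.
move=> vs Oy YT [r r0 H].
have qE : quadp (v y) q Y y y = v y.
  by rewrite /quadp subrr /qform !edot0r mulr0 !addr0.
have := vs y (quadp (v y) q Y y) setT Oy.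
rewrite grad_quadp// hess_quadp// qE; apply.
- by split; [exact: openT|].
- exact: C2_on_quadp.
- split=> //.
  apply/near_enormP; exists r => // z zr.
  have yzy : y + z - y = z by rewrite addrAC subrr add0r.
  by rewrite -subr_eq0 yzy => z0; rewrite /quadp yzy H.
Qed.

End Quadratic.

(** * A family of operators containing both laplacians *)

Section Operator.
Context {R : realType} {n : nat}.
Implicit Types (x y z q : 'rV[R]_n) (Y : 'M[R]_n).

(** With [th = 1 / p] this is the homogeneous [p]-laplacian, and with [th = 0]
    the homogeneous infinity laplacian. *)
Definition mix_lap (th : R) : operator R n :=
  fun _ q Y => (1 - 2 * th) * (enorm q ^+ 2)^-1 * (q *m Y *m q^T) 0 0 + th * \tr Y.

Lemma inf_laplacianE : @inf_laplacian R n = mix_lap 0.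
Proof.
apply/funext => s; apply/funext => q; apply/funext => Y.
by rewrite /inf_laplacian /mix_lap mulr0 subr0 mul1r mul0r addr0.
Qed.

Lemma p_laplacianE (p : R) : p != 0 -> @p_laplacian R n p = mix_lap p^-1.
Proof.
move=> p0; apply/funext => s; apply/funext => q; apply/funext => Y.
by rewrite /p_laplacian /mix_lap mulrBl divff.
Qed.

Lemma lsc_env_le (F : operator R n) s q Y : q != 0 -> Y^T = Y ->
  (lsc_env F s q Y <= (F s q Y)%:E)%E.
Proof.
move=> q0 YT; rewrite /lsc_env limf_einfE; apply: ge_ereal_sup => _ [A FA <-].
apply: ereal_inf_lbound; exists (s, q, Y) => //.
have : nbhs (s, q, Y) [set z : R * 'rV[R]_n * 'M[R]_n |
  z.1.2 != 0 /\ z.2^T = z.2 -> A z] := FA.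
by move=> /nbhs_singleton; apply.
Qed.

Lemma lsc_env_ge (F : operator R n) s q Y (B : R) :
  (exists2 r, 0 < r & forall t xi X, xi != 0 -> enorm (xi - q) < r ->
    `|X - Y| < r -> B <= F t xi X) ->
  (B%:E <= lsc_env F s q Y)%E.
Proof.
move=> [r r0 H]; rewrite /lsc_env limf_einfE; apply: le_ereal_sup_tmp.
pose f (z : R * 'rV[R]_n * 'M[R]_n) := (F z.1.1 z.1.2 z.2)%:E.
pose A := [set z : R * 'rV[R]_n * 'M[R]_n | B <= F z.1.1 z.1.2 z.2].
exists (ereal_inf (f @` A)); last first.
  by apply: le_ereal_inf_tmp => _ [z Az <-]; rewrite lee_fin.
exists A => //.
have /nbhs_ballP[d /= d0 Hd] : nbhs q [set xi | enorm (xi - q) < r].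
  by apply/near_enormP; exists r => // z; rewrite /= addrAC subrr add0r.
have : nbhs (s, q, Y) [set z : R * 'rV[R]_n * 'M[R]_n |
    z.1.2 != 0 /\ z.2^T = z.2 -> A z].
  apply/nbhs_ballP; exists (Num.min r d); first by rewrite /= lt_min r0.
  move=> [[t xi] X] [[/= _ xib] Xb] [/= xi0 _]; apply: (H t xi X xi0).
    by apply: Hd; move: xib; rewrite -ball_normE/= lt_min => /andP[].
  by move: Xb; rewrite -ball_normE/= lt_min distrC => /andP[].
by [].
Qed.

Lemma qform_ge Y xi (e : R) : (forall i j, `|Y i j| <= e) ->
  - (e * n%:R ^+ 2 * enorm xi ^+ 2) <= qform Y xi.
Proof.
move=> Ye; rewrite lerNl; apply: le_trans (ler_norm _) _; rewrite normrN qform_sum.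
under eq_bigr do rewrite mulr_sumr.
apply: le_trans (ler_norm_sum _ _ _) _.
apply: (@le_trans _ _ (\sum_(j < n) \sum_(i < n) e * enorm xi ^+ 2)).
  apply: ler_sum => j _; apply: le_trans (ler_norm_sum _ _ _) _.
  apply: ler_sum => i _; rewrite mulrA 2!normrM mulrC expr2.
  by rewrite ler_pM// ?mulr_ge0// ler_pM// coord_le_enorm.
rewrite !sumr_const !card_ord -mulrnA -[leLHS]mulr_natr natrM -expr2.
by rewrite mulrAC.
Qed.

(** Lower bound for the envelope from a lower bound [B] of the Rayleigh quotients
    [xi Y xi^T / |xi|^2] for [xi] near [q]; it applies also when [q = 0]. *)
Lemma mix_lap_env_ge (th : R) s q Y (B : R) : 0 <= th -> 2 * th <= 1 ->
  (exists2 r, 0 < r & forall xi, xi != 0 -> enorm (xi - q) < r ->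
    B * enorm xi ^+ 2 <= qform Y xi) ->
  forall k, 0 < k ->
  (((1 - 2 * th) * B + th * \tr Y - k)%:E <= lsc_env (mix_lap th) s q Y)%E.
Proof.
move=> th0 th1 [r r0 H] k k0; apply: lsc_env_ge.
pose N : R := 1 + n%:R ^+ 2 + n%:R.
have N0 : 0 < N by rewrite /N -addrA ltr_pwDl// addr_ge0// sqr_ge0.
exists (Num.min r (k / N)); first by rewrite lt_min r0 divr_gt0.
move=> t xi X xi0; rewrite !lt_min => /andP[xir _] /andP[_ /ltW XY].
set e := k / N in XY.
have XYij i j : `|(X - Y) i j| <= e by rewrite (le_trans (mx_coord_le _ _ _)).
have x2 : 0 < enorm xi ^+ 2 by rewrite exprn_gt0// enorm_gt0.
have H1 : B - e * n%:R ^+ 2 <= (enorm xi ^+ 2)^-1 * (xi *m X *m xi^T) 0 0.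
  rewrite qformE [leRHS]mulrC ler_pdivlMr// mulrBl -(subrK Y X) addrC qformDm.
  by rewrite lerD ?H// qform_ge.
have H2 : \tr Y - e * n%:R <= \tr X.
  rewrite lerBlDl -lerBlDr -raddfB/= /mxtrace.
  rewrite (@le_trans _ _ (\sum_(i < n) e))//; last first.
    by rewrite sumr_const card_ord mulr_natr.
  apply: ler_sum => i _; apply: le_trans (ler_norm _) _.
  by rewrite -opprB mxE normrN.
have eN : e * n%:R ^+ 2 + e * n%:R <= k.
  rewrite -mulrDr /e mulrAC ler_pdivrMr// ler_pM2l// /N -addrA lerDr//.
rewrite /mix_lap -mulrA.
have th2 : 0 <= 1 - 2 * th by rewrite subr_ge0.
have := ler_wpM2l th2 H1; have := ler_wpM2l th0 H2.
have e0 : 0 <= e by rewrite ltW// divr_gt0.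
have en2 : 0 <= e * n%:R ^+ 2 by apply: mulr_ge0 => //; exact: sqr_ge0.
have en1 : 0 <= e * n%:R by apply: mulr_ge0.
have : (1 - 2 * th) * (e * n%:R ^+ 2) <= e * n%:R ^+ 2.
  by apply: ler_piMl => //; lra.
have : th * (e * n%:R) <= e * n%:R by apply: ler_piMl => //; lra.
by rewrite !mulrBr; lra.
Qed.

End Operator.

Section Radial.
Context {R : realType} {n : nat}.
Implicit Types (y z : 'rV[R]_n).

(** The Hessian at [y] of a radial function [g |x|], where [m = g'' |y|] and
    [k = g' |y| / |y|]. *)
Definition radial_hess (k m : R) y : 'M[R]_n :=
  k%:M + ((m - k) / enorm y ^+ 2) *: (y^T *m y).

Lemma radial_hess_sym k m y : (radial_hess k m y)^T = radial_hess k m y.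
Proof. by rewrite /radial_hess linearD linearZ/= trmx_mul trmxK tr_scalar_mx. Qed.

Lemma qform_radial k m y z : qform (radial_hess k m y) z =
  k * enorm z ^+ 2 + (m - k) / enorm y ^+ 2 * edot y z ^+ 2.
Proof. by rewrite /radial_hess qformDm qform_scalar qformZm qform_rank1. Qed.

Lemma tr_radial k m y : y != 0 -> \tr (radial_hess k m y) = k * n%:R + (m - k).
Proof.
move=> y0; rewrite /radial_hess mxtraceD mxtraceZ mxtrace_scalar mxtrace_mulC.
have -> : \tr (y *m y^T) = enorm y ^+ 2 by rewrite enorm_sqr /mxtrace big_ord1.
by rewrite divfK ?mulr_natr// expf_neq0// enorm_eq0.
Qed.

(** The scalar inequality behind [radial_expansion], for [d = |y|], [N = |z|],
    [b = y . z] and [t = |y + z| - |y|]: the increment [t] is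
    [b / d + (N^2 - t^2) / (2 d)], hence [b / d] up to [N^2]. *)
Lemma radial_arith (d N b t s m e : R) : 0 < d -> 0 <= N -> `|t| <= N ->
  `|b| <= d * N -> (d + t) ^+ 2 = d ^+ 2 + 2 * b + N ^+ 2 ->
  N * (1 + `|(m - s / d) / 2|) < e / 2 * d -> 0 < e ->
  s * t + m / 2 * t ^+ 2 + e / 2 * t ^+ 2 <=
  s / d * b + 2^-1 * (s / d * N ^+ 2 + (m - s / d) / d ^+ 2 * b ^+ 2) + e * N ^+ 2.
Proof.
move=> d0 N0 tN bN Eq Ne e0.
have dn0 : d != 0 by rewrite gt_eqF.
pose K := (m - s / d) / 2; pose u := b / d.
have uN : `|u| <= N by rewrite normrM normfV (gtr0_norm d0) ler_pdivrMr// mulrC.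
have tu : t - u = (N ^+ 2 - t ^+ 2) / (2 * d).
  have -> : N ^+ 2 = (d + t) ^+ 2 - d ^+ 2 - 2 * b by rewrite Eq; ring.
  by rewrite /u; field.
have t2N : t ^+ 2 <= N ^+ 2 by rewrite -(real_normK (num_real t)) ler_pXn2r ?nnegrE.
have tuN : `|t - u| <= N ^+ 2 / (2 * d).
  rewrite tu ger0_norm; last by rewrite divr_ge0 ?subr_ge0// mulr_ge0// ltW.
  by rewrite ler_pM2r ?invr_gt0 ?mulr_gt0// gerBl sqr_ge0.
have Ktu : K * (t ^+ 2 - u ^+ 2) <= e / 2 * N ^+ 2.
  apply: le_trans (ler_norm _) _; rewrite normrM subr_sqr [X in _ * X]normrM.
  apply: (@le_trans _ _ (`|K| * (N ^+ 2 / (2 * d) * (2 * N)))).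
    rewrite ler_wpM2l// ler_pM// (le_trans (ler_normD _ _))//; lra.
  rewrite [leLHS](_ : _ = (N * `|K|) / d * N ^+ 2); last by field.
  rewrite ler_wpM2r ?sqr_ge0// ler_pdivrMr//.
  by rewrite (le_trans _ (ltW Ne))// ler_wpM2l// lerDr.
have -> : s * t + m / 2 * t ^+ 2 + e / 2 * t ^+ 2 =
    s / d * b + 2^-1 * (s / d * N ^+ 2) + K * t ^+ 2 + e / 2 * t ^+ 2.
  have -> : N ^+ 2 = (d + t) ^+ 2 - d ^+ 2 - 2 * b by rewrite Eq; ring.
  by rewrite /K; field.
have -> : s / d * b + 2^-1 * (s / d * N ^+ 2 + (m - s / d) / d ^+ 2 * b ^+ 2) +
    e * N ^+ 2 = s / d * b + 2^-1 * (s / d * N ^+ 2) + K * u ^+ 2 + e * N ^+ 2.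
  by rewrite /K /u; field.
have : e / 2 * t ^+ 2 <= e / 2 * N ^+ 2 by rewrite ler_wpM2l// divr_ge0// ltW.
by move: Ktu; rewrite mulrBr; lra.
Qed.

(** A second-order upper expansion of [g] at [|y|] gives one of [g |x|] at [y]. *)
Lemma radial_expansion (g : R -> R) y (s m : R) : y != 0 ->
  (forall e, 0 < e -> exists2 r, 0 < r & forall t, `|t| < r ->
    g (enorm y + t) <= g (enorm y) + s * t + m / 2 * t ^+ 2 + e * t ^+ 2) ->
  forall e, 0 < e -> exists2 r, 0 < r & forall z, enorm z < r ->
    g (enorm (y + z)) <= g (enorm y) + edot ((s / enorm y) *: y) z +
      2^-1 * qform (radial_hess (s / enorm y) m y) z + e * enorm z ^+ 2.
Proof.
move=> y0 H e e0; have e20 : 0 < e / 2 by rewrite divr_gt0.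
have [r r0 Hr] := H _ e20.
have d0 : 0 < enorm y by rewrite enorm_gt0.
pose K := (m - s / enorm y) / 2.
have K0 : 0 < 1 + `|K| by rewrite ltr_pwDl.
exists (Num.min r (e / 2 * enorm y / (1 + `|K|))).
  by rewrite lt_min r0 !divr_gt0// mulr_gt0.
move=> z; rewrite lt_min => /andP[zr]; rewrite ltr_pdivlMr// => zK.
pose t := enorm (y + z) - enorm y.
have tz : `|t| <= enorm z by exact: ler_enorm_dist.
have := Hr t (le_lt_trans tz zr); rewrite {1}/t addrC subrK qform_radial edotZl.
have Eq := enormD_sqr y z; have yzE : enorm (y + z) = enorm y + t.
  by rewrite /t addrCA subrr addr0.
rewrite {}yzE in Eq => gH.
have := radial_arith d0 (enorm_ge0 z) tz (cauchy_schwarz y z) Eq zK e0.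
by move: gH; lra.
Qed.

End Radial.

(** * Upper bound for the principal eigenvalue *)

Section UpperBound.
Context {R : realType} {n : nat}.
Implicit Types (x y z q xi : 'rV[R]_n) (Y : 'M[R]_n).

Lemma sin_le (t : R) : 0 <= t -> sin t <= t.
Proof.
move=> t0; have [s _] := @MVT_abs R sin cos t (fun s _ => is_derive_sin s).
by rewrite sin0 subr0 => ->; rewrite ler_piMl// cos_le1.
Qed.

(** Second-order upper expansion of [- cos (a t + b)]. *)
Lemma cos_taylor (a b t e : R) : 0 < e -> exists2 r, 0 < r & forall h, `|h| < r ->
  - cos (a * (t + h) + b) <= - cos (a * t + b) + a * sin (a * t + b) * h +
    a ^+ 2 * cos (a * t + b) / 2 * h ^+ 2 + e * h ^+ 2.
Proof.
move=> e0.
have D0 (s : R) : is_derive s 1 (fun s => a * s + b) a.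
  apply/is_derive_epsP => d d0; exists 1 => // h _.
  rewrite /= [h *: 1]mulr1 (_ : _ - _ = 0).
    by rewrite normr0 mulr_ge0// ltW.
  by ring.
have Ds (s : R) : is_derive s 1 (fun s => - cos (a * s + b)) (a * sin (a * s + b)).
  have H := @is_derive1_comp R cos (fun s => a * s + b) s _ _ (is_derive_cos _) (D0 s).
  by apply: (is_derive_eq (is_deriveN H)); rewrite mulNr opprK mulrC.
have Dc : is_derive t 1 (fun s => a * sin (a * s + b)) (a ^+ 2 * cos (a * t + b)).
  have H := @is_derive1_comp R sin (fun s => a * s + b) t _ _ (is_derive_sin _) (D0 t).
  apply: (is_derive_eq (is_deriveZ a H)); rewrite /GRing.scale/=; ring.
have [|r r0 H] := @taylor2 R (fun s => - cos (a * s + b))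
  (fun s => a * sin (a * s + b)) t _ _ Dc _ e0; first by near=> s.
exists r => // h /H; rewrite ler_norml => /andP[_]; lra.
Unshelve. all: by end_near. Qed.

(** At [q != 0] it is enough to bound the Rayleigh quotient at [q]. *)
Lemma mix_lap_env_ge_regular (th : R) s q Y (B : R) : 0 <= th -> 2 * th <= 1 ->
  B * enorm q ^+ 2 < qform Y q -> forall k, 0 < k ->
  (((1 - 2 * th) * B + th * \tr Y - k)%:E <= lsc_env (mix_lap th) s q Y)%E.
Proof.
move=> th0 th1 Bq; apply: mix_lap_env_ge => //.
pose f xi := edot ((xi - 0) *m (Y - B%:M)) xi.
have fE xi : f xi = qform Y xi - B * enorm xi ^+ 2.
  by rewrite /f subr0 -/(qform (Y - B%:M) xi) qformDm qformNm qform_scalar.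
have cf : {for q, continuous f}.
  apply: continuous_edot; last exact: cvg_id.
  exact: continuous_mulmx.
have f0 : 0 < f q by rewrite fE subr_gt0.
have : \forall xi \near q, 0 < f xi.
  by apply: (cvgr_gt (f q) cf).
move=> /near_enormP[r r0 H]; exists r => // xi _ xiq.
have := H _ xiq; rewrite addrC subrK fE => /ltW; by rewrite subr_ge0.
Qed.

(** At every point [y] with [a |y| < pi], the function [cos (a |x|)] is touched
    strictly from below by a quadratic polynomial. The envelope of the operator at the
    (rescaled) polynomial is, up to terms in [e], at least the value that [cos (a |x|)]
    itself gives: its second derivative is [- m] in the radial direction and [- k] in
    the others. At the origin, where the gradient vanishes, [k = m]. *)
Lemma cos_radial_test (th a e : R) y : 0 <= th -> 2 * th <= 1 -> 0 < e -> 0 < a ->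
  a * enorm y < pi ->
  let m := a ^+ 2 * cos (a * enorm y) in
  exists q, exists2 Y, Y^T = Y &
  [/\ exists2 r, 0 < r & forall z, z != 0 -> enorm z < r ->
      cos (a * enorm y) + edot q z + 2^-1 * qform Y z < cos (a * enorm (y + z)) &
    exists2 k, 0 <= k <= a ^+ 2 & forall c s, 0 < c ->
      ((c * ((1 - 2 * th) * (- m - 5 * e) +
             th * (- (k * n%:R + (m - k)) - 4 * e * n%:R) - e))%:E
        <= lsc_env (mix_lap th) s (c *: q) (c *: Y))%E].
Proof.
move=> th0 th1 e0 a0 ypi m.
have strict (A B N : R) : 0 < N -> A - e * N <= B -> A - 2 * e * N < B.
  by move=> N0; apply: lt_le_trans; rewrite -mulrA ltrD2l ltrN2 ltr_pMl ?mulr_gt0// ltr1n.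
have [y0|y0] := eqVneq y 0.
  have m2 : m = a ^+ 2 by rewrite /m y0 enorm0 mulr0 cos0 mulr1.
  (* At the origin all Rayleigh quotients of the Hessian are equal. *)
  exists 0, ((- (a ^+ 2) - 4 * e)%:M); first by rewrite tr_scalar_mx.
  split.
    have [r r0 H] := cos_taylor a 0 0 e0; exists r => // z z0 zr.
    have := H (enorm z); rewrite ger0_norm ?enorm_ge0// => /(_ zr).
    rewrite mulr0 !add0r !addr0 sin0 cos0 mulr0 mul0r mulr1 y0 enorm0 mulr0 cos0.
    rewrite add0r edot0l addr0 qform_scalar => K.
    have N0 : 0 < enorm z ^+ 2 by rewrite exprn_gt0// enorm_gt0.
    have := mulr_gt0 e0 N0; lra.
  exists (a ^+ 2); first by rewrite sqr_ge0 lexx.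
  move=> c s c0; rewrite scaler0 -scalemx1 scalerA scalemx1.
  have H : exists2 r, 0 < r & forall xi, xi != 0 -> enorm (xi - 0) < r ->
      c * (- a ^+ 2 - 4 * e) * enorm xi ^+ 2 <= qform (c * (- a ^+ 2 - 4 * e))%:M xi.
    by exists 1 => // xi _ _; rewrite qform_scalar.
  apply: le_trans (mix_lap_env_ge s th0 th1 H (mulr_gt0 c0 e0)).
  rewrite lee_fin mxtrace_scalar m2 -[(c * _) *+ n]mulr_natr.
  have : 0 <= c * ((1 - 2 * th) * e) by rewrite !mulr_ge0 ?subr_ge0// ltW.
  lra.
pose k := a * sin (a * enorm y) / enorm y.
exists (- ((k) *: y)), (- radial_hess k m y - (4 * e)%:M).
  by rewrite linearB linearN/= radial_hess_sym tr_scalar_mx.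
have ny : 0 < enorm y by rewrite enorm_gt0.
have sy : 0 < sin (a * enorm y) by rewrite sin_gt0_pi// mulr_gt0.
have k0 : 0 < k by rewrite /k divr_gt0// mulr_gt0.
have qf z : qform (- radial_hess k m y - (4 * e)%:M) z =
    - qform (radial_hess k m y) z - 4 * e * enorm z ^+ 2.
  by rewrite qformDm !qformNm qform_scalar.
split.
  have [|r r0 H] := @radial_expansion R n (fun t => - cos (a * t)) y
    (a * sin (a * enorm y)) m y0 _ _ e0.
    move=> d d0; have [r r0 Hr] := cos_taylor a 0 (enorm y) d0.
    by exists r => // t /Hr; rewrite !addr0.
  exists r => // z z0 /H; rewrite -/k qf edotNl.
  have N0 : 0 < enorm z ^+ 2 by rewrite exprn_gt0// enorm_gt0.
  have := mulr_gt0 e0 N0; lra.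
exists k.
  rewrite ltW//= /k ler_pdivrMr// expr2 -mulrA ler_pM2l// sin_le// ltW//.
  by rewrite mulr_gt0.
move=> c s c0.
have q2 : enorm (c *: - (k *: y)) ^+ 2 = (c * k) ^+ 2 * enorm y ^+ 2.
  by rewrite enorm_sqr edotZl edotZr edotNl edotNr edotZl edotZr -enorm_sqr; ring.
have yq : edot y (- (k *: y)) = - (k * enorm y ^+ 2).
  by rewrite edotNr edotZr enorm_sqr.
have H : c * (- m - 5 * e) * enorm (c *: - (k *: y)) ^+ 2 <
    qform (c *: (- radial_hess k m y - (4 * e)%:M)) (c *: - (k *: y)).
  rewrite q2 qformZm qformZ qf qform_radial yq enormN enormZ (gtr0_norm k0).
  rewrite -subr_gt0 (_ : _ - _ = c ^+ 3 * k ^+ 2 * enorm y ^+ 2 * e).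
    by do !apply: mulr_gt0 => //; apply: exprn_gt0.
  by field; rewrite gt_eqF.
apply: le_trans (mix_lap_env_ge_regular s th0 th1 H (mulr_gt0 c0 e0)).
rewrite lee_fin mxtraceZ linearB linearN/= tr_radial ?gt_eqF// mxtrace_scalar.
rewrite -[(4 * e) *+ n]mulr_natr.
by rewrite le_eqVlt; apply/orP; left; apply/eqP; ring.
Qed.


End UpperBound.

Section UpperBoundMain.
Context {R : realType} {n : nat}.
Implicit Types (x y z : 'rV[R]_n) (Om : set 'rV[R]_n).

(** In a ball of radius [r] with [pi / 2 < a r < pi], a multiple of
    [w = cos (a |x - x0|) - cos (a r)] touches the positive supersolution [v] from
    below at a maximum of [w / v]. There [F_th w + a^2 w] is at least
    [a^2 (- cos (a r) - th (n + 1))], which is positive, whence [lam < a^2]. *)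
Lemma visc_super_lt Om (v : 'rV[R]_n -> R) x0 (r a lam th : R) :
  open Om -> (forall x, enorm (x - x0) <= r -> Om x) ->
  {within Om, continuous v} -> (forall x, Om x -> 0 < v x) ->
  visc_super (mix_lap th) lam Om v ->
  0 <= th -> 2 * th <= 1 -> 0 < a -> pi / 2 < a * r -> a * r < pi ->
  th * (n%:R + 1) < - cos (a * r) -> lam < a ^+ 2.
Proof.
move=> oOm Bsub cv v0 vs th0 th1 a0 ar1 ar2 theps; rewrite ltNge; apply/negP => alam.
have r0 : 0 < r by rewrite -(pmulr_rgt0 _ a0) (lt_trans _ ar1)// divr_gt0// pi_gt0.
pose eps := - cos (a * r); pose w x := cos (a * enorm (x - x0)) + eps.
have eps0 : 0 < eps by apply: le_lt_trans theps; rewrite mulr_ge0// addr_ge0.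
pose K := [set x | enorm (x - x0) <= r].
have KOm : K `<=` Om by [].
have x0K : K x0 by rewrite /K/= subrr enorm0 ltW.
have cw : {within K, continuous (fun x => w x / v x)}.
  apply: continuous_in_subspaceT => x /set_mem Kx.
  have vx := v0 _ (KOm _ Kx).
  apply: continuousM; last first.
    apply: continuousV; first by rewrite gt_eqF.
    move: cv; rewrite continuous_open_subspace// => /(_ x); apply.
    exact/mem_set/KOm.
  apply: continuousD; last exact: cst_continuous.
  apply: (@continuous_comp _ _ _ (fun x => a * enorm (x - x0)) cos); last first.
    exact: continuous_cos.
  apply: continuousM; first exact: cst_continuous.
  exact: continuous_enormB.
(* The maximum is positive and [w] vanishes on the sphere, so [y] is interior. *)
have [y /set_mem Ky ymax] := EVT_max_rV (ex_intro _ x0 x0K) (@compact_eball R n x0 r) cw.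
have vy : 0 < v y := v0 _ (KOm _ Ky).
have wy : 0 < w y.
  have : 0 < w y / v y.
    apply: lt_le_trans (ymax x0 (mem_set x0K)).
    rewrite divr_gt0// ?v0//; last exact: KOm.
    by rewrite /w subrr enorm0 mulr0 cos0 addr_gt0.
  by rewrite pmulr_lgt0// invr_gt0.
have yr : enorm (y - x0) < r.
  rewrite lt_neqAle Ky andbT; apply/eqP => yr.
  by move: wy; rewrite /w yr subrr ltxx.
pose c := v y / w y.
have c0 : 0 < c by rewrite divr_gt0.
have cwv x : K x -> c * w x <= v x.
  move=> Kx; have := ymax x (mem_set Kx).
  rewrite ler_pdivrMr ?v0//; last exact: KOm.
  rewrite -(ler_pM2l c0) => /le_trans; apply.
  by rewrite /c [leLHS](_ : _ = v x)//; field; rewrite !gt_eqF.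
have cwy : c * w y = v y by rewrite /c divfK// gt_eqF.
pose C := cos (a * enorm (y - x0)).
have gap : 0 < a ^+ 2 * (eps - th * (n%:R + 1)) by rewrite mulr_gt0 ?exprn_gt0// subr_gt0.
(* The error terms in [e] add up to less than [e (7 + 4 n)]. *)
pose e := a ^+ 2 * (eps - th * (n%:R + 1)) / (7 + 4 * n%:R).
have n7 : 0 < 7 + 4 * n%:R :> R by rewrite ltr_pwDl// mulr_ge0.
have e0 : 0 < e by rewrite divr_gt0.
have ypi : a * enorm (y - x0) < pi by rewrite (lt_trans _ ar2)// ltr_pM2l.
have [q [Y YT [[d d0 Hd] [k /andP[k0 ka] Hk]]]] := cos_radial_test th0 th1 e0 a0 ypi.
have := visc_super_quad (q := c *: q) (Y := c *: Y) vs (KOm _ Ky).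
rewrite linearZ/= YT => /(_ erefl) vq.
have {}vq : (lsc_env (mix_lap th) (v y) (c *: q) (c *: Y) + (lam * v y)%:E <= 0)%E.
  apply: vq; exists (Num.min d (r - enorm (y - x0))); first by rewrite lt_min d0 subr_gt0.
  move=> z z0; rewrite lt_min => /andP[zd zr].
  have Kyz : K (y + z).
    rewrite /K/= addrAC (le_trans (ler_enormD _ _))//.
    by move: zr; lra.
  apply: lt_le_trans (cwv _ Kyz); rewrite -cwy edotZl qformZm.
  rewrite mulrCA -!mulrDr ltr_pM2l// /w (addrAC y).
  by have := Hd z z0 zd; lra.
move: vq; apply/negP; rewrite -ltNge; apply: lt_le_trans (leeD2r _ (Hk c (v y) c0)).
rewrite -EFinD lte_fin -cwy (mulrCA lam) -mulrDr pmulr_rgt0//.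
have nn : 0 <= n%:R :> R by [].
have : e * (7 + 4 * n%:R) = a ^+ 2 * (eps - th * (n%:R + 1)) by rewrite /e divfK// gt_eqF.
have : a ^+ 2 * w y <= lam * w y by rewrite ler_pM2r.
have : th * (k * n%:R) <= th * (a ^+ 2 * n%:R) by rewrite ler_wpM2l// ler_wpM2r//.
have : 0 <= th * k by rewrite mulr_ge0.
have : th * (e * n%:R) <= e * n%:R.
  by apply: ler_piMl; [rewrite mulr_ge0// ltW|lra].
have : th * e >= 0 by rewrite mulr_ge0// ltW.
have : 0 <= th * a ^+ 2 * (1 + C).
  have C1 : 0 <= 1 + C by have := cos_geN1 (a * enorm (y - x0)); rewrite -/C; lra.
  by apply: mulr_ge0 => //; apply: mulr_ge0 => //; exact: sqr_ge0.
rewrite /w -/C; lra.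
Qed.

End UpperBoundMain.

(** * Lower bound for the principal eigenvalue *)

Section Distance.
Context {R : realType} {n : nat}.
Implicit Types (x y z : 'rV[R]_n) (A : set 'rV[R]_n).

Lemma edist_le A x y : A y -> edist_to A x <= enorm (x - y).
Proof.
move=> Ay; apply: ge_inf; last by exists y.
by exists 0 => _ [z _ <-]; exact: enorm_ge0.
Qed.

Lemma edist_attained A x : closed A -> A !=set0 ->
  exists2 y, A y & edist_to A x = enorm (x - y).
Proof.
move=> cA [y0 Ay0]; pose K := [set y | enorm (y - x) <= enorm (y0 - x)] `&` A.
have cK : compact K by apply: compact_closedI => //; exact: compact_eball.
have [||y /set_mem [_ Ay] ymin] := @EVT_min_rV R n (fun y => enorm (y - x)) K _ cK.
- by exists y0; split => /=.
- by apply: continuous_subspaceT => y; exact: continuous_enormB.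
exists y => //; apply/eqP; rewrite eq_le edist_le//=.
apply: lb_le_inf; first by exists (enorm (x - y0)), y0.
move=> _ [z Az <-]; rewrite !(enorm_distC x).
have [zK|/ltW zK] := leP (enorm (z - x)) (enorm (y0 - x)).
  by apply: ymin; rewrite inE.
by rewrite (le_trans _ zK)// ymin// inE; split=> /=.
Qed.

Lemma edist_lipschitz A x z : closed A -> A !=set0 ->
  `|edist_to A (x + z) - edist_to A x| <= enorm z.
Proof.
move=> cA A0; rewrite ler_norml; apply/andP; split.
  have [y Ay ->] := edist_attained (x + z) cA A0.
  have := edist_le x Ay; have := ler_enormD (x + z - y) (- z).
  by rewrite enormN addrAC addrK; lra.
have [y Ay ->] := edist_attained x cA A0.
have := edist_le (x + z) Ay; have := ler_enormD (x - y) z.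
by rewrite (addrAC x); lra.
Qed.

Lemma continuous_edist A : closed A -> A !=set0 -> continuous (edist_to A).
Proof.
move=> cA A0 x; apply/(cvgrPdist_lt (FF := nbhs_filter x)) => e e0.
apply/near_enormP; exists e => // z ze; rewrite distrC.
by apply: le_lt_trans ze; exact: edist_lipschitz.
Qed.

End Distance.

Section TouchingRadial.
Context {R : realType} {n : nat}.
Implicit Types (x y z : 'rV[R]_n) (U : set 'rV[R]_n).

(** First- and second-order conditions for a minimum at [0]. *)
Lemma quadratic_ge0 (D E r : R) : 0 < r ->
  (forall t, `|t| < r -> 0 <= t * D + t ^+ 2 * E) -> D = 0 /\ 0 <= E.
Proof.
move=> r0 H.
have Hle (D' : R) : (forall t, `|t| < r -> 0 <= t * D' + t ^+ 2 * E) -> D' <= 0.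
  move=> H'; rewrite leNgt; apply/negP => D0.
  have E0 : 0 < 1 + `|E| by rewrite ltr_pwDl.
  pose t := Num.min (r / 2) (D' / (1 + `|E|) / 2).
  have t0 : 0 < t by rewrite lt_min !divr_gt0.
  have tr : t < r.
    by apply: (@le_lt_trans _ _ (r / 2)); [rewrite ge_min lexx|lra].
  have tD : t * (1 + `|E|) <= D' / 2.
    by rewrite -ler_pdivlMr// mulrAC ge_min lexx orbT.
  have := H' (- t); rewrite normrN gtr0_norm// => /(_ tr).
  rewrite sqrrN mulNr addrC subr_ge0 expr2 -mulrA ler_pM2l// => DtE.
  have tE : t * E <= t * (1 + `|E|).
    by rewrite ler_pM2l// (le_trans (ler_norm E))// lerDr.
  lra.
have D0 : D = 0.
  apply/eqP; rewrite eq_le Hle//= -oppr_le0; apply: Hle => t tr.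
  by have := H (- t); rewrite normrN => /(_ tr); rewrite sqrrN mulNr mulrN.
split=> //; have r2 : `|r / 2| < r by rewrite gtr0_norm ?divr_gt0//; lra.
have := H _ r2; rewrite D0 mulr0 add0r pmulr_rge0// exprn_gt0// divr_gt0//.
Qed.

Lemma qform_delta (Y : 'M[R]_n) i : qform Y 'e_i = Y i i.
Proof. by rewrite /qform edot_delta -rowE mxE. Qed.

(** Suppose that a test function [psi] touches the radial function [g |x' - y|] from
    below at [x], where [g] has slope [s > 0] and second derivative [m]. Then the
    gradient of [psi] is that of the radial function, and its Hessian is at most that
    of the radial function as a quadratic form; this bounds the operator. *)
Lemma radial_touch (th s m : R) (g : R -> R) U (psi : 'rV[R]_n -> R) x y :
  0 <= th -> 2 * th <= 1 -> 0 < s -> x != y ->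
  open U -> U x -> C2_on U psi -> psi x = g (enorm (x - y)) ->
  (\forall x' \near x, psi x' <= g (enorm (x' - y))) ->
  (forall e, 0 < e -> exists2 r, 0 < r & forall t, `|t| < r ->
    g (enorm (x - y) + t) <= g (enorm (x - y)) + s * t + m / 2 * t ^+ 2 + e * t ^+ 2) ->
  (lsc_env (mix_lap th) (psi x) (grad psi x) (hess psi x) <=
    ((1 - th) * m + th * (n%:R * (s / enorm (x - y))))%:E)%E.
Proof.
move=> th0 th1 s0 xy oU Ux C2 psix psile Hg.
set y' := x - y; have y0 : y' != 0 by rewrite subr_eq0.
have d0 : 0 < enorm y' by rewrite enorm_gt0.
pose k := s / enorm y'; have k0 : 0 < k by rewrite divr_gt0.
set q := grad psi x; set Y := hess psi x.
(* Compare the two expansions along the line of direction [z]. *)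
have key z e : 0 < e -> edot (k *: y' - q) z = 0 /\
    0 <= (qform (radial_hess k m y') z - qform Y z) / 2 + e * (1 + enorm z ^+ 2).
  move=> e0; have [r1 r10 H1] := radial_expansion y0 Hg e0.
  have [r2 r20 H2] := C2_taylor z oU C2 Ux e0.
  have [r3 r30 H3] := near_line z psile.
  have z1 : 0 < 1 + enorm z by rewrite ltr_pwDl// enorm_ge0.
  apply: (@quadratic_ge0 _ _ (Num.min (r1 / (1 + enorm z)) (Num.min r2 r3))).
    by rewrite !lt_min r20 r30 divr_gt0.
  move=> t; rewrite !lt_min => /and3P[t1 t2 t3].
  have tz : enorm (t *: z) < r1.
    rewrite enormZ; move: t1; rewrite ltr_pdivlMr//; apply: le_lt_trans.
    by rewrite ler_wpM2l// lerDr.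
  have := H1 _ tz; have := H2 _ t2; have := H3 _ t3.
  rewrite ler_norml => K3 /andP[K2 _]; rewrite -/k -/y'.
  move: K2 K3; rewrite (addrAC x (t *: z)) -/y' -/q -/Y psix -/y'.
  rewrite edotZr qformZ enormZ exprMn real_normK ?num_real// edotBl.
  lra.
have qE : q = k *: y'.
  apply/eqP; rewrite eq_sym -subr_eq0 -edot_eq0.
  by have [->] := key (k *: y' - q) 1 ltr01.
have Yle z : qform Y z <= qform (radial_hess k m y') z.
  rewrite -subr_ge0 leNgt; apply/negP => neg.
  set D := qform _ _ - _ in neg.
  have N1 : 0 < 1 + enorm z ^+ 2 by rewrite ltr_pwDl// sqr_ge0.
  have e0 : 0 < - D / 4 / (1 + enorm z ^+ 2) by rewrite !divr_gt0// oppr_gt0.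
  by have [_] := key z _ e0; rewrite divfK ?gt_eqF// -/D; lra.
have q0 : q != 0 by rewrite qE scaler_eq0 negb_or gt_eqF.
have YT : Y^T = Y by exact: hess_sym Ux.
apply: le_trans (lsc_env_le _ _ q0 YT) _.
rewrite lee_fin /mix_lap qformE.
have q2 : 0 < enorm q ^+ 2 by rewrite exprn_gt0// enorm_gt0.
have trY : \tr Y <= k * n%:R + (m - k).
  rewrite -(@tr_radial _ _ _ m _ y0) /mxtrace; apply: ler_sum => i _.
  by rewrite -!qform_delta.
have Yq : (enorm q ^+ 2)^-1 * qform Y q <= m.
  rewrite mulrC ler_pdivrMr//; apply: le_trans (Yle q) _.
  rewrite qform_radial [in edot _ _]qE edotZr -enorm_sqr qE enormZ.
  rewrite exprMn real_normK ?num_real// le_eqVlt; apply/orP; left; apply/eqP.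
  by field; rewrite gt_eqF.
have th2 : 0 <= 1 - 2 * th by rewrite subr_ge0.
have := ler_wpM2l th2 Yq; have := ler_wpM2l th0 trY.
have := mulr_ge0 th0 (ltW k0).
rewrite -/k mulrA; lra.
Qed.

End TouchingRadial.

Section Barrier.
Context {R : realType} {n : nat}.
Implicit Types (x y z : 'rV[R]_n) (Om : set 'rV[R]_n).

Lemma sin_taylor (a b t e : R) : 0 < e -> exists2 r, 0 < r & forall h, `|h| < r ->
  sin (a * (t + h + b)) <= sin (a * (t + b)) + a * cos (a * (t + b)) * h +
    - (a ^+ 2 * sin (a * (t + b))) / 2 * h ^+ 2 + e * h ^+ 2.
Proof.
move=> e0; have [r r0 H] := cos_taylor a (a * b + pi / 2) t e0.
exists r => // h /H; rewrite !addrA -!mulrDr !cosDpihalf sinDpihalf !opprK.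
by rewrite !(mulNr, mulrN).
Qed.

(** With [A = sqrt t] and [u = sqrt (t + h) - A], the remainder is a polynomial in
    [u], [1 / A] of order [u^3]. *)
Lemma sqrt_taylor (M t e : R) : 0 < t -> 0 < M -> 0 < e ->
  exists2 r, 0 < r & forall h, `|h| < r ->
    M * Num.sqrt (t + h) <= M * Num.sqrt t + M / (2 * Num.sqrt t) * h +
      - (M / (4 * (t * Num.sqrt t))) / 2 * h ^+ 2 + e * h ^+ 2.
Proof.
move=> t0 M0 e0; pose A := Num.sqrt t.
have A0 : 0 < A by rewrite sqrtr_gt0.
have tA : t = A ^+ 2 by rewrite sqr_sqrtr// ltW.
exists (Num.min (A ^+ 2) (e / M * A ^+ 5)).
  by rewrite lt_min exprn_gt0//=; apply: mulr_gt0; [exact: divr_gt0|exact: exprn_gt0].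
move=> h; rewrite lt_min => /andP[h1 h2].
rewrite -/A; pose u := Num.sqrt (t + h) - A.
have th0 : 0 <= t + h by move: h1; rewrite -tA ltr_norml => /andP[]; lra.
have uE : Num.sqrt (t + h) = A + u by rewrite /u addrCA subrr addr0.
have Au : 0 <= A + u by rewrite -uE sqrtr_ge0.
have hE : h = u * (2 * A + u).
  have : (A + u) ^+ 2 = A ^+ 2 + h by rewrite -uE sqr_sqrtr// tA.
  by move=> E; rewrite -[h](addKr (A ^+ 2)) -E; ring.
have uh : `|u| * A <= `|h|.
  by rewrite hE normrM ler_wpM2l// (ger0_norm (_ : 0 <= _)); lra.
have uA : `|u| <= A.
  by rewrite -(ler_pM2r A0) (le_trans uh)// ltW// -expr2.
rewrite uE tA -subr_ge0.
set X := (X in 0 <= X).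
have XE : X = e * h ^+ 2 - M * u ^+ 3 * (4 * A + u) / (8 * A ^+ 3).
  by rewrite /X hE; field; rewrite gt_eqF.
rewrite XE subr_ge0 ler_pdivrMr ?mulr_gt0 ?exprn_gt0//.
apply: (@le_trans _ _ (M * (`|u| ^+ 3 * (5 * A)))).
  rewrite -mulrA ler_pM2l// (le_trans (ler_norm _))// normrM normrX.
  rewrite ler_wpM2l ?exprn_ge0// (le_trans (ler_normD _ _))//.
  by rewrite (gtr0_norm (_ : 0 < 4 * A)) ?mulr_gt0//; lra.
have h2' : `|h| * M <= e * A ^+ 5.
  by rewrite -ler_pdivlMr// mulrAC ltW.
have hh : `|h| ^+ 2 = h ^+ 2 by rewrite real_normK ?num_real.
have u3 : `|u| ^+ 3 * A ^+ 3 <= `|h| ^+ 3.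
  by rewrite -exprMn lerXn2r ?nnegrE ?mulr_ge0// ltW.
have A2 : 0 < A ^+ 2 by rewrite exprn_gt0.
rewrite -(ler_pM2r A2).
have -> : M * (`|u| ^+ 3 * (5 * A)) * A ^+ 2 = 5 * M * (`|u| ^+ 3 * A ^+ 3) by ring.
apply: (@le_trans _ _ (5 * (h ^+ 2 * (`|h| * M)))).
  have -> : 5 * (h ^+ 2 * (`|h| * M)) = 5 * M * `|h| ^+ 3 by rewrite -hh; ring.
  by rewrite ler_wpM2l ?mulr_ge0// ltW.
apply: (@le_trans _ _ (5 * (h ^+ 2 * (e * A ^+ 5)))).
  by rewrite ler_wpM2l// ler_wpM2l// sqr_ge0.
rewrite [leRHS](_ : _ = 8 * (h ^+ 2 * (e * A ^+ 5))); last by ring.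
rewrite ler_wpM2r ?ler_nat// mulr_ge0 ?sqr_ge0// mulr_ge0 ?exprn_ge0// ltW//.
Qed.

(** The barrier [v = min (sin (a (d + eta)), M sqrt d)], where [d] is the distance to
    the complement: the sine has the right eigenvalue, and the square root, which
    is the minimum where [d] is small, absorbs the singularity of the tangential
    second derivatives at the boundary. *)
Lemma barrier_visc_super Om (a eta rho lam th : R) :
  let A := ~` Om in let d := edist_to A in
  let sigma := sin (a * eta) in let M := (Num.sqrt (rho / 8))^-1 in
  let v x := Num.min (sin (a * (d x + eta))) (M * Num.sqrt (d x)) in
  open Om -> A !=set0 -> (forall x, Om x -> d x <= rho) ->
  0 < a -> 0 < eta -> 0 < rho -> a * (rho + 2 * eta) = pi / 2 ->
  lam < a ^+ 2 -> 0 <= th -> 2 * th <= 1 -> th * (4 + 8 * n%:R) <= 1 ->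
  th * (a ^+ 2 + n%:R * a * (8 / (sigma ^+ 2 * rho))) <= (a ^+ 2 - lam) * sigma ->
  [/\ {within Om, continuous v}, forall x, Om x -> 0 < v x &
    visc_super (mix_lap th) lam Om v].
Proof.
move=> A d sigma M v oOm A0 drho a0 eta0 rho0 api lama th0 th1 th2 th3.
have cA : closed A by exact: open_closedC.
have aeta : 0 < a * eta by rewrite mulr_gt0.
have arho : 0 < a * rho by rewrite mulr_gt0.
have sigma0 : 0 < sigma by rewrite sin_gt0_pihalf// aeta/=; lra.
have rho8 : 0 < Num.sqrt (rho / 8) by rewrite sqrtr_gt0 divr_gt0.
have M0 : 0 < M by rewrite invr_gt0.
have M2 : M ^+ 2 = 8 / rho.
  by rewrite exprVn sqr_sqrtr ?divr_ge0// ?(ltW rho0)// invf_div.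
have Omd x : Om x -> exists2 y, A y & x != y /\ d x = enorm (x - y).
  move=> Ox; have [y Ay dE] := edist_attained x cA A0.
  by exists y => //; split=> //; apply: contraPneq Ay => <- /(_ Ox).
have d0 x : Om x -> 0 < d x.
  by move=> /Omd[y _ [xy ->]]; rewrite enorm_gt0 subr_eq0.
(* The sine is monotone slightly beyond the maximal distance [rho], because [eta > 0];
   so the comparison with a radial function holds also at points where [d = rho]. *)
have sin_mono t t' : 0 <= t -> t <= t' -> t' <= rho + eta ->
    sin (a * (t + eta)) <= sin (a * (t' + eta)).
  move=> t0 tt' t'r.
  have H1 : a * t' <= a * (rho + eta) by rewrite ler_pM2l.
  have H2 : a * t <= a * t' by rewrite ler_pM2l.
  have H3 : 0 <= a * t by rewrite mulr_ge0// ltW.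
  have H4 : 0 < a * eta := aeta.
  move: tt'; rewrite le_eqVlt => /orP[/eqP->//|tt'].
  rewrite ltW// ltr_sin ?ltr_pM2l ?ltrD2r// in_itv/=; apply/andP; split; lra.
have sin_cos t : 0 <= t -> t <= rho ->
    sigma <= sin (a * (t + eta)) /\ 0 < cos (a * (t + eta)).
  move=> t0 tr; split.
    by rewrite /sigma -{1}[eta]add0r; apply: sin_mono => //; rewrite ler_wpDr// ltW.
  have H2 : a * t <= a * rho by rewrite ler_pM2l.
  have H3 : 0 <= a * t by rewrite mulr_ge0// ltW.
  by apply: cos_gt0_pihalf; apply/andP; split; lra.
split.
- apply: continuous_subspaceT => x.
  apply: (@continuous_min _ _ (fun x => sin (a * (d x + eta)))
    (fun x => M * Num.sqrt (d x)) x).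
    apply: (@continuous_comp _ _ _ (fun x => a * (d x + eta)) sin); last exact: continuous_sin.
    apply: continuousM; first exact: cst_continuous.
    by apply: continuousD; [exact: continuous_edist|exact: cst_continuous].
  apply: continuousM; first exact: cst_continuous.
  apply: (@continuous_comp _ _ _ d Num.sqrt); last exact: sqrt_continuous.
  exact: continuous_edist.
- move=> x Ox; rewrite lt_min mulr_gt0 ?sqrtr_gt0 ?d0// andbT.
  apply: lt_le_trans sigma0 _.
  by have [] := sin_cos (d x) (ltW (d0 x Ox)) (drho x Ox).
move=> x psi U Ox [oU Ux] C2 [psix psilt].
have [y Ay [xy dE]] := Omd x Ox.
have dx0 := d0 x Ox; have dxr := drho x Ox.
have Om_near : nbhs x Om by exact: open_nbhs_nbhs.
have y_near : nbhs x [set x' | enorm (x' - y) < rho + eta].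
  apply: (@cvgr_lt _ _ (nbhs x) (nbhs_filter x) _ _ (@continuous_enormB R n y x)).
  by rewrite -dE; lra.
have le_near : nbhs x [set x' | psi x' <= v x' /\ Om x' /\ enorm (x' - y) < rho + eta].
  have := @filterI _ _ (nbhs_filter x) _ _ psilt
    (@filterI _ _ (nbhs_filter x) _ _ Om_near y_near).
  apply: (@filterS _ _ (nbhs_filter x)) => x' [psi' ?]; split=> //.
  by have [->|/psi'/ltW//] := eqVneq x' x; rewrite psix.
have [Sle Cgt] := sin_cos (d x) (ltW dx0) dxr.
set S := sin _ in Sle; set C := cos _ in Cgt.
have vE : v x = Num.min S (M * Num.sqrt (d x)) by [].
have n0 : 0 <= n%:R :> R by [].
(* Where the sine is the minimum, [d x] is bounded below; where the square root is,
   [d x <= rho / 8]. *)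
have [SM|MS] := leP S (M * Num.sqrt (d x)).
  have {}vE : v x = S by rewrite vE min_l.
  have s0 : 0 < a * C by rewrite mulr_gt0.
  have := @radial_touch R n th (a * C) (- (a ^+ 2 * S)) (fun t => sin (a * (t + eta)))
    U psi x y th0 th1 s0 xy oU Ux C2.
  rewrite -dE -/S psix vE => /(_ erefl) H.
  have {}H : (lsc_env (mix_lap th) S (grad psi x) (hess psi x) <=
    ((1 - th) * - (a ^+ 2 * S) + th * (n%:R * (a * C / d x)))%:E)%E.
    apply: H; last first.
      by move=> e e0; exact: sin_taylor.
    apply: (@filterS _ _ (nbhs_filter x)) le_near => x' [psi' [Ox' yr]].
    apply: le_trans psi' _; rewrite ge_min; apply/orP; left.
    by apply: sin_mono; [exact/ltW/d0|exact: edist_le|exact: ltW].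
  apply: le_trans (leeD2r _ H) _; rewrite -EFinD lee_fin.
  have dlow : sigma ^+ 2 * rho / 8 <= d x.
    have : sigma ^+ 2 <= (M * Num.sqrt (d x)) ^+ 2.
      rewrite lerXn2r ?nnegrE ?(ltW sigma0)// ?(le_trans Sle)//.
      by rewrite mulr_ge0 ?sqrtr_ge0// ltW.
    rewrite exprMn M2 sqr_sqrtr ?(ltW dx0)// => K.
    by rewrite ler_pdivrMr// -ler_pdivlMr//; move: K; congr (_ <= _); ring.
  have aCd : a * C / d x <= a * (8 / (sigma ^+ 2 * rho)).
    rewrite -mulrA ler_pM2l// (@le_trans _ _ (d x)^-1)//.
      by rewrite ler_piMl ?cos_le1// invr_ge0 ltW.
    rewrite -invf_div lef_pV2 ?posrE// divr_gt0// mulr_gt0// exprn_gt0//.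
  have : th * (n%:R * (a * C / d x)) <= th * (n%:R * (a * (8 / (sigma ^+ 2 * rho)))).
    by rewrite ler_wpM2l// ler_wpM2l.
  have : (a ^+ 2 - lam) * sigma <= (a ^+ 2 - lam) * S by rewrite ler_pM2l ?subr_gt0.
  have : th * a ^+ 2 * S <= th * a ^+ 2.
    by rewrite ler_piMr ?sin_le1// mulr_ge0 ?sqr_ge0.
  by move: th3; rewrite mulrDr -!mulrA; lra.
have {}vE : v x = M * Num.sqrt (d x) by rewrite vE min_r// ltW.
set D := Num.sqrt (d x) in MS vE *.
have D0 : 0 < D by rewrite sqrtr_gt0.
have dD : d x = D ^+ 2 by rewrite sqr_sqrtr// ltW.
have s0 : 0 < M / (2 * D) by rewrite divr_gt0// mulr_gt0.
have := @radial_touch R n th (M / (2 * D)) (- (M / (4 * (d x * D))))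
  (fun t => M * Num.sqrt t) U psi x y th0 th1 s0 xy oU Ux C2.
rewrite -dE -/D psix vE => /(_ erefl) H.
have {}H : (lsc_env (mix_lap th) (M * D) (grad psi x) (hess psi x) <=
    ((1 - th) * - (M / (4 * (d x * D))) + th * (n%:R * (M / (2 * D) / d x)))%:E)%E.
  apply: H; last first.
    by move=> e e0; exact: sqrt_taylor.
  apply: (@filterS _ _ (nbhs_filter x)) le_near => x' [psi' [Ox' yr]].
  apply: le_trans psi' _; rewrite ge_min; apply/orP; right.
  by rewrite ler_pM2l// ler_sqrt ?enorm_ge0// edist_le.
apply: le_trans (leeD2r _ H) _; rewrite -EFinD lee_fin.
have dup : d x <= rho / 8.
  have : (M * D) ^+ 2 <= 1.
    by rewrite expr_le1// ?mulr_ge0// ?ltW// (lt_le_trans MS)// sin_le1.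
  rewrite exprMn -dD M2 => K.
  by rewrite ler_pdivlMr// -[rho]mulr1 -ler_pdivrMl//; move: K; congr (_ <= _); ring.
have lamd : lam * d x ^+ 2 <= 1 / 16.
  apply: (@le_trans _ _ ((a * d x) ^+ 2)).
    by rewrite exprMn ler_wpM2r ?sqr_ge0// ltW.
  have ad : a * d x <= 1 / 4.
    have : a * d x <= a * (rho / 8) by rewrite ler_pM2l.
    by have := @pihalf_lt2 R; lra.
  have ad0 : 0 <= a * d x by rewrite mulr_ge0// ltW.
  by have := ler_pM ad0 ad0 ad ad; rewrite -expr2; lra.
have -> : (1 - th) * - (M / (4 * (d x * D))) + th * (n%:R * (M / (2 * D) / d x)) +
    lam * (M * D) = M / D ^+ 3 * (- ((1 - th) / 4) + th * n%:R / 2 + lam * d x ^+ 2).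
  by rewrite dD; field; rewrite gt_eqF.
rewrite mulr_ge0_le0 ?divr_ge0 ?exprn_ge0 ?ltW//; lra.
Qed.

End Barrier.

(** * The principal eigenvalue near the infinity laplacian *)

Section Eigenvalue.
Context {R : realType} {n : nat}.
Implicit Types (x : 'rV[R]_n).

Section Inradius.
Context (Om : set 'rV[R]_n) (rho : R).
Context (domOm : domain Om) (OmC0 : ~` Om !=set0).
Context (rhomax : is_max [set edist_to (~` Om) x | x in closure Om] rho).

Lemma edist_le_inradius x : Om x -> edist_to (~` Om) x <= rho.
Proof. by move=> Ox; case: rhomax => _; apply; exists x => //; exact: subset_closure. Qed.

Lemma inradius_gt0 : 0 < rho.
Proof.
have [[x Ox] oOm _] := domOm; apply: lt_le_trans (edist_le_inradius Ox).
have [y Ay ->] := edist_attained x (open_closedC oOm) OmC0.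
rewrite enorm_gt0 subr_eq0; apply/eqP => xy.
by apply: Ay; rewrite -xy.
Qed.

Lemma inscribed_ball : exists x0, forall r, r < rho ->
  forall x, enorm (x - x0) <= r -> Om x.
Proof.
case: rhomax => -[x0 _ d0] _; exists x0 => r rrho x xr.
apply: contrapT => Ax; have := @edist_le _ _ (~` Om) x0 x Ax.
by rewrite d0 enorm_distC; lra.
Qed.

Lemma lambda1_upper (l : R) : (pi / (2 * rho)) ^+ 2 < l ->
  exists2 t, 0 < t & forall th, 0 <= th < t ->
    (lambda1 (mix_lap th) Om <= l%:E)%E.
Proof.
move=> bl; have rho0 := inradius_gt0; have [x0 Hball] := inscribed_ball.
have [_ oOm _] := domOm.
set b := pi / (2 * rho) in bl *.
have b0 : 0 < b by rewrite divr_gt0 ?pi_gt0// mulr_gt0.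
have l0 : 0 < l by apply: lt_trans bl; rewrite exprn_gt0.
have brho : b * rho = pi / 2 by rewrite /b; field; rewrite gt_eqF.
(* The bound [3 b / 2] keeps [a r] below [pi]. *)
pose a := Num.min (Num.sqrt l) (3 / 2 * b).
have ba : b < a.
  rewrite lt_min; apply/andP; split; last by lra.
  by rewrite -(ger0_norm (ltW b0)) -sqrtr_sqr ltr_sqrt.
have a0 : 0 < a by exact: lt_trans ba.
have al : a ^+ 2 <= l.
  rewrite -[leRHS](sqr_sqrtr (ltW l0)) lerXn2r ?nnegrE ?sqrtr_ge0 ?(ltW a0)//.
  by rewrite ge_min lexx.
have a32 : a <= 3 / 2 * b by rewrite ge_min lexx orbT.
pose r := rho * (1 + b / a) / 2.
have arE : a * r = (a * rho + b * rho) / 2 by rewrite /r; field; rewrite gt_eqF.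
have rrho : r < rho.
  have : b / a < 1 by rewrite ltr_pdivrMr// mul1r.
  by rewrite -(ltr_pM2l rho0) mulr1 /r; lra.
have arho : pi / 2 < a * rho by rewrite -brho ltr_pM2r.
have arho' : a * rho <= 3 / 2 * (pi / 2).
  by rewrite -brho mulrA ler_wpM2r// ltW.
have pi0 := @pi_gt0 R.
have ar1 : pi / 2 < a * r by rewrite arE brho; lra.
have ar2 : a * r < pi by rewrite arE brho; lra.
have eps0 : 0 < - cos (a * r).
  rewrite oppr_gt0 -[X in _ < X](@cos_pihalf R) ltr_cos// in_itv/=; apply/andP; split; lra.
have N0 : 0 < n%:R + 1 :> R by rewrite ltr_wpDl.
exists (Num.min (1 / 2) (- cos (a * r) / (n%:R + 1))).
  by rewrite lt_min !divr_gt0.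
move=> th; rewrite lt_min => /and3P[th0 th1 th2].
apply: ge_ereal_sup => _ [lam [v [cv v0 vs]] <-]; rewrite lee_fin.
apply: le_trans al; apply: ltW.
apply: (visc_super_lt oOm (Hball _ rrho) cv v0 vs th0 _ a0 ar1 ar2); first lra.
by rewrite -ltr_pdivlMr.
Qed.

Lemma lambda1_lower (l : R) : l < (pi / (2 * rho)) ^+ 2 ->
  exists2 t, 0 < t & forall th, 0 <= th < t ->
    (l%:E <= lambda1 (mix_lap th) Om)%E.
Proof.
move=> bl; have rho0 := inradius_gt0; have [_ oOm _] := domOm.
set b := pi / (2 * rho) in bl *.
have b0 : 0 < b by rewrite divr_gt0 ?pi_gt0// mulr_gt0.
have brho : b * rho = pi / 2 by rewrite /b; field; rewrite gt_eqF.
pose a := Num.sqrt ((Num.max l 0 + b ^+ 2) / 2).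
have b2 : 0 < b ^+ 2 by rewrite exprn_gt0.
have lb : Num.max l 0 < b ^+ 2 by rewrite gt_max bl.
have l0 : 0 <= Num.max l 0 by rewrite le_max lexx orbT.
have ll : l <= Num.max l 0 by rewrite le_max lexx.
have a2 : a ^+ 2 = (Num.max l 0 + b ^+ 2) / 2 by rewrite sqr_sqrtr//; lra.
have a0 : 0 < a by rewrite sqrtr_gt0; lra.
have ab : a < b.
  by rewrite -(@ltr_pXn2r _ 2) ?nnegrE ?(ltW a0) ?(ltW b0)// a2; lra.
have la : l < a ^+ 2 by rewrite a2; lra.
pose eta := (pi / (2 * a) - rho) / 2.
have api : a * (rho + 2 * eta) = pi / 2 by rewrite /eta; field; rewrite gt_eqF.
have eta0 : 0 < eta.
  have : a * rho < b * rho by rewrite ltr_pM2r.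
  rewrite brho -api ltr_pM2l//; lra.
have aeta : 0 < a * eta by rewrite mulr_gt0.
have arho : 0 < a * rho by rewrite mulr_gt0.
have sigma0 : 0 < sin (a * eta).
  by apply: sin_gt0_pihalf; apply/andP; split; lra.
set sigma := sin (a * eta) in sigma0.
have n0 : 0 <= n%:R :> R by [].
pose K := a ^+ 2 + n%:R * a * (8 / (sigma ^+ 2 * rho)).
have K0 : 0 < K.
  rewrite /K ltr_pwDl ?exprn_gt0// mulr_ge0//; first by rewrite mulr_ge0// ltW.
  by rewrite divr_ge0// mulr_ge0 ?sqr_ge0// ltW.
have N0 : 0 < 4 + 8 * n%:R :> R by rewrite ltr_pwDl// mulr_ge0.
exists (Num.min (1 / (4 + 8 * n%:R)) ((a ^+ 2 - l) * sigma / K)).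
  by rewrite lt_min !divr_gt0// mulr_gt0// subr_gt0.
move=> th; rewrite lt_min => /and3P[th0].
rewrite !ltr_pdivlMr// => th1 th2.
have thn : 0 <= th * n%:R by rewrite mulr_ge0.
apply: ereal_sup_ubound; exists l => //; eexists.
apply: (barrier_visc_super oOm OmC0 edist_le_inradius a0 eta0 rho0 api la th0);
  [lra|exact: ltW|exact: ltW].
Qed.

End Inradius.
End Eigenvalue.

Theorem mainTheorem4 (R : realType) (n : nat) (Omega : set 'rV[R]_n) (rho : R)
  (hOmega : domain Omega)
  (hOmegaC : ~` Omega !=set0)
  (hrho : is_max [set edist_to (~` Omega) x | x in closure Omega] rho) :
  (lambda1 (p_laplacian p) Omega @[p --> +oo] --> ((pi / (2 * rho)) ^+ 2)%:E)
  /\ ((pi / (2 * rho)) ^+ 2)%:E = lambda1 (@inf_laplacian R n) Omega.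
Proof.
set L := (pi / (2 * rho)) ^+ 2.
have upper := lambda1_upper hOmega hOmegaC hrho.
have lower := lambda1_lower hOmega hOmegaC hrho.
have near_p (t : R) : 0 < t -> \forall p \near +oo,
    @p_laplacian R n p = mix_lap p^-1 /\ 0 <= p^-1 < t.
  move=> t0; near=> p.
  have p0 : 0 < p by near: p; exact: nbhs_pinfty_gt.
  split; first by rewrite p_laplacianE// gt_eqF.
  rewrite invr_ge0 (ltW p0)/= invf_plt ?posrE//.
  by near: p; apply: nbhs_pinfty_gt; exact: num_real.
have bounds (e : R) : 0 < e -> \forall p \near +oo,
    ((L - e)%:E <= lambda1 (@p_laplacian R n p) Omega <= (L + e)%:E)%E.
  move=> e0.
  have [|t t0 Ht] := lower (L - e); first by rewrite ltrBlDr ltrDl.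
  have [|t' t'0 Ht'] := upper (L + e); first by rewrite ltrDl.
  have tt : 0 < Num.min t t' by rewrite lt_min t0.
  near=> p.
  have [-> /andP[p0]] : @p_laplacian R n p = mix_lap p^-1 /\ 0 <= p^-1 < Num.min t t'.
    by near: p; exact: near_p.
  rewrite lt_min => /andP[pt pt'].
  by rewrite Ht ?p0// Ht' ?p0.
split.
  apply/fine_cvgP; split.
    near=> p.
    have /andP[H1 H2] : ((L - 1)%:E <= lambda1 (@p_laplacian R n p) Omega <= (L + 1)%:E)%E.
      by near: p; exact: bounds.
    by rewrite fin_numElt (lt_le_trans (ltNyr _) H1) (le_lt_trans H2 (ltry _)).
  apply/cvgrPdist_le => e e0; near=> p.
  have /andP[] : ((L - e)%:E <= lambda1 (@p_laplacian R n p) Omega <= (L + e)%:E)%E.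
    by near: p; exact: bounds.
  rewrite /=; case: (lambda1 _ _) => // l; rewrite !lee_fin => H1 H2.
  by rewrite /= ler_norml; apply/andP; split; lra.
rewrite inf_laplacianE; apply/eqP; rewrite eq_le; apply/andP; split.
  apply/lee_subgt0Pr => e e0; rewrite -EFinB.
  have [|t t0] := lower (L - e); first by rewrite ltrBlDr ltrDl.
  by apply; rewrite lexx.
apply/lee_addgt0Pr => e e0; rewrite -EFinD.
have [|t t0] := upper (L + e); first by rewrite ltrDl.
by apply; rewrite lexx.
Unshelve. all: by end_near. Qed.
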